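(* Let $\Omega\subset\mathbb{R}^d$ be a bounded connected open set with Lipschitz boundary, let $\delta>0$, $\nu(h)=\mathbf{1}_{B_\delta(0)}(h)$, $\Omega(\delta)=\{x\in\mathbb{R}^d\setminus\Omega:\operatorname{dist}(x,\partial\Omega)<\delta\}$ and $E=\Omega\cup\Omega(\delta)$. Let $f\in L^2(\Omega)$ and $g\in V_\nu(\Omega|E)$. Then there is a unique $u\in V_\nu(\Omega|E)$ such that $$u-g\in V_{\nu,0}(\Omega|E)\qquad\text{and}\qquad \mathcal{E}(u,v)=\int_\Omega f(x)v(x)\,dx\quad\text{for all } v\in V_{\nu,0}(\Omega|E)$$ (i.e. a unique variational solution of the Dirichlet problem $Lu=f$ in $\Omega$, $u=g$ on $\Omega(\delta)$). Moreover, there is a constant $C>0$ independent of $f$ and $g$ such that $$\|u\|_{V_\nu(\Omega|E)}\le C\big(\|f\|_{L^2(\Omega)}+\|g\|_{V_\nu(\Omega|E)}\big).$$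
   Context: $V_\nu(\Omega|E)$ is the space of measurable $u:E\to\mathbb{R}$ with $u|_\Omega\in L^2(\Omega)$ and $|u|^2_{V_\nu(\Omega|E)}=\int_\Omega\int_E (u(x)-u(y))^2\nu(x-y)\,dy\,dx<\infty$, with $\|u\|^2_{V_\nu(\Omega|E)}=\|u\|^2_{L^2(\Omega)}+|u|^2_{V_\nu(\Omega|E)}$; functions equal a.e. on $E$ are identified. $V_{\nu,0}(\Omega|E)=\{u\in V_\nu(\Omega|E): u=0 \text{ a.e. on }\Omega(\delta)\}$. The bilinear form is $$\mathcal{E}(u,v)=\frac12\iint_{(\Omega^c\times\Omega^c)^c}(u(x)-u(y))(v(x)-v(y))\nu(x-y)\,dx\,dy,$$ where $(\Omega^c\times\Omega^c)^c$ is the set of pairs with at least one of $x,y$ in $\Omega$; since $\nu$ is supported in $B_\delta(0)$, only pairs $(x,y)\in E\times E$ contribute. $Lu(x)=\mathrm{p.v.}\int_{\mathbb{R}^d}(u(x)-u(y))\nu(x-y)\,dy$. *)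

(* Defs.v *)
From HB Require Import structures.
From mathcomp Require Import all_boot all_order all_algebra.
From mathcomp Require Import all_classical all_reals all_analysis.
Import Order.TTheory GRing.Theory Num.Theory.
Import numFieldNormedType.Exports.

Set Implicit Arguments.
Unset Strict Implicit.
Unset Printing Implicit Defensive.

Local Open Scope classical_set_scope.
Local Open Scope ring_scope.

(* R^d is 'rV[R]_d.  Its sigma-algebra is generated by the coordinates, as the
   library does for n.-tuple; it is the Borel sigma-algebra of R^d. *)

Definition measure_rV_display : measure_display. Proof. exact: default_measure_display. Qed.

Section measurable_rV.
Context {R : realType} (n : nat).

Let coords : 'I_n -> 'rV[R]_n -> R := fun i x => x ord0 i.

Let rV_set0 : g_sigma_preimage coords set0.
Proof. exact: sigma_algebra0. Qed.

Let rV_setC A : g_sigma_preimage coords A -> g_sigma_preimage coords (~` A).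
Proof. exact: sigma_algebraC. Qed.

Let rV_bigcup (F : _^nat) : (forall i, g_sigma_preimage coords (F i)) ->
  g_sigma_preimage coords (\bigcup_i (F i)).
Proof. exact: sigma_algebra_bigcup. Qed.

HB.instance Definition _ := @isMeasurable.Build measure_rV_display
  'rV[R]_n (g_sigma_preimage coords) rV_set0 rV_setC rV_bigcup.

End measurable_rV.

Section coordinates_rV.
Context {R : realType}.

Lemma measurable_coord n (i : 'I_n) :
  measurable_fun [set: 'rV[R]_n] (fun x : 'rV[R]_n => x ord0 i).
Proof.
move=> _ Y mY; rewrite setTI; apply: sub_sigma_algebra => /=.
rewrite -bigcup_seq/=; exists i => /=; first by rewrite mem_index_enum.
by exists Y => //; rewrite setTI.
Qed.

Lemma measurable_fun_coordP d (T : measurableType d) n (f : T -> 'rV[R]_n) :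
  measurable_fun [set: T] f <->
  forall i, measurable_fun [set: T] (fun x => f x ord0 i).
Proof.
split=> [mf i|mf]; first exact: measurableT_comp (measurable_coord i) mf.
have : g_sigma_preimage (fun i => (fun x : 'rV[R]_n => x ord0 i) \o f)
    `<=` measurable.
  apply: smallest_sub; first exact: sigma_algebra_measurable.
  case: n => [|n] in f mf *; first by rewrite big_ord0.
  rewrite -bigcup_mkord_ord; apply: bigcup_sub => i Ii.
  by move=> A [B mB <-]; exact: mf.
rewrite g_sigma_preimage_comp => prefS _ A mA.
by apply: prefS; exists A.
Qed.

Definition cons_rV n (p : R * 'rV[R]_n) : 'rV[R]_n.+1 :=
  row_mx (const_mx p.1 : 'rV[R]_1) p.2.

Definition uncons_rV n (x : 'rV[R]_n.+1) : R * 'rV[R]_n :=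
  (x ord0 ord0, rsubmx (x : 'rV[R]_(1 + n))).

Lemma cons_rVE n (p : R * 'rV[R]_n) i :
  cons_rV p ord0 i = if unlift ord0 i is Some j then p.2 ord0 j else p.1.
Proof.
rewrite /cons_rV; case: unliftP => [j|] ->.
  have -> : lift ord0 j = rshift 1 j :> 'I_n.+1 by exact: (@val_inj nat _ 'I_n.+1).
  exact: row_mxEr.
have -> : ord0 = lshift n (ord0 : 'I_1) :> 'I_n.+1 by exact: (@val_inj nat _ 'I_n.+1).
by apply: etrans (@row_mxEl _ 1 1 n _ _ _ _) _; rewrite mxE.
Qed.

Lemma cons_rVK n : cancel (@cons_rV n) (@uncons_rV n).
Proof.
move=> [a x]; rewrite /uncons_rV cons_rVE unlift_none; congr pair.
exact: row_mxKr.
Qed.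

Lemma measurable_cons_rV n : measurable_fun [set: R * 'rV[R]_n] (@cons_rV n).
Proof.
apply/measurable_fun_coordP => i; under eq_fun do rewrite cons_rVE.
case: (unlift ord0 i) => [j|]; last exact: measurable_fst.
exact: measurableT_comp (measurable_coord j) measurable_snd.
Qed.

Lemma measurable_uncons_rV n : measurable_fun [set: 'rV[R]_n.+1] (@uncons_rV n).
Proof.
apply/measurable_fun_pair; first exact: measurable_coord.
apply/measurable_fun_coordP => i; under eq_fun do rewrite mxE.
exact: measurable_coord.
Qed.

End coordinates_rV.

Section lebesgue_step.
Context {R : realType} (n : nat).
Variable mu : {sigma_finite_measure set 'rV[R]_n -> \bar R}.

Definition lebesgue_step : set 'rV[R]_n.+1 -> \bar R :=
  pushforward (@lebesgue_measure R \x mu)%E (@cons_rV R n).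

Let mcons := @measurable_cons_rV R n.

Let step0 : lebesgue_step set0 = 0%E.
Proof. exact: measure0. Qed.

Let step_ge0 A : (0 <= lebesgue_step A)%E.
Proof. exact: measure_ge0. Qed.

Let step_sigma_additive : semi_sigma_additive lebesgue_step.
Proof. exact: measure_semi_sigma_additive. Qed.

HB.instance Definition _ := isMeasure.Build _ _ _ lebesgue_step
  step0 step_ge0 step_sigma_additive.

Let step_sigma_finite : sigma_finite setT lebesgue_step.
Proof.
have /sigma_finiteP[F [FT ndF Foo]] := sigma_finiteT (@lebesgue_measure R).
have /sigma_finiteP[G [GT ndG Goo]] := sigma_finiteT mu.
exists (fun i => @uncons_rV R n @^-1` (F i `*` G i)).
  rewrite -preimage_bigcup [X in _ @^-1` X](_ : _ = setT) ?preimage_setT//.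
  apply/seteqP; split=> // -[a x] _.
  have [k _ Fka] : (\bigcup_i F i) a by rewrite -FT.
  have [l _ Glx] : (\bigcup_i G i) x by rewrite -GT.
  exists (maxn k l) => //; split=> /=.
    by move: a Fka; exact/subsetPset/ndF/leq_maxl.
  by move: x Glx; exact/subsetPset/ndG/leq_maxr.
move=> i; have [mF Fi] := Foo i; have [mG Gi] := Goo i; split.
  rewrite -[X in measurable X]setTI; apply: measurable_uncons_rV => //.
  exact: measurableX.
rewrite /lebesgue_step /pushforward -comp_preimage.
rewrite (_ : _ \o _ = id) ?preimage_id; last exact/funext/cons_rVK.
by rewrite product_measure1E// lte_mul_pinfty// ge0_fin_numE.
Qed.

HB.instance Definition _ := Measure_isSigmaFinite.Build _ _ _ lebesgue_step
  step_sigma_finite.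

End lebesgue_step.

(* Lebesgue measure on R^n, as an iterated product of Lebesgue measure on R. *)
Fixpoint lebesgue_rV {R : realType} (n : nat) :
    {sigma_finite_measure set 'rV[R]_n -> \bar R} :=
  match n with
  | 0%N => \d_(0 : 'rV[R]_0)
  | m.+1 => lebesgue_step (lebesgue_rV m)
  end.

Section euclidean.
Context {R : realType} {d : nat}.
Implicit Types (x p : 'rV[R]_d) (A Omega : set 'rV[R]_d).

(* The library's norm on 'rV[R]_d is the sup norm. *)
Definition enorm x : R := Num.sqrt (\sum_i x ord0 i ^+ 2).

(* +oo when A is empty *)
Definition edist x A : \bar R := ereal_inf [set (enorm (x - y))%:E | y in A].

Definition boundary A : set 'rV[R]_d := closure A `&` closure (~` A).

End euclidean.

(* Near each boundary point, in suitable orthonormal coordinates, Omega is the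
   set of points lying strictly above the graph of a Lipschitz function of the
   d - 1 remaining coordinates. *)
Definition lipschitz_boundary {R : realType} {d : nat} (Omega : set 'rV[R]_d) :=
  forall p, boundary Omega p ->
  exists (r : R) (Q : 'M[R]_d) (i : 'I_d) (phi : 'rV[R]_d.-1 -> R) (K : R),
    [/\ 0 < r, Q *m Q^T = 1%:M,
        forall y z, `|phi y - phi z| <= K * enorm (y - z) &
        forall x, enorm (x - p) < r ->
          (Omega x <-> phi (col' i ((x - p) *m Q)) < ((x - p) *m Q) ord0 i)].

Section nonlocal_dirichlet.
Context {R : realType} {d : nat}.
Local Notation mu := (@lebesgue_rV R d).
Implicit Types (A Omega : set 'rV[R]_d) (delta : R) (f g u v : 'rV[R]_d -> R).

Definition L2_sqnorm A u : \bar R := (\int[mu]_(x in A) ((u x) ^+ 2)%:E)%E.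

Definition L2 A u : Prop := measurable_fun A u /\ (L2_sqnorm A u < +oo)%E.

Definition L2_norm A u : R := Num.sqrt (fine (L2_sqnorm A u)).

Definition nu delta : 'rV[R]_d -> R := \1_[set h | enorm h < delta].

Definition collar Omega delta : set 'rV[R]_d :=
  [set x | ~ Omega x /\ (edist x (boundary Omega) < delta%:E)%E].

Definition domE Omega delta : set 'rV[R]_d := Omega `|` collar Omega delta.

(* A function on E is represented by a function on R^d whose values off E are
   irrelevant, and functions equal almost everywhere on E are identified. *)

Definition V_sqseminorm Omega delta u : \bar R :=
  (\int[mu]_(x in Omega) \int[mu]_(y in domE Omega delta)
    ((u x - u y) ^+ 2 * nu delta (x - y))%:E)%E.

Definition V_nu Omega delta u : Prop :=
  [/\ measurable_fun (domE Omega delta) u, L2 Omega u &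
      (V_sqseminorm Omega delta u < +oo)%E].

Definition V_norm Omega delta u : R :=
  Num.sqrt (fine (L2_sqnorm Omega u + V_sqseminorm Omega delta u)%E).

Definition V_nu0 Omega delta u : Prop :=
  V_nu Omega delta u /\ u = cst 0 %[ae mu in collar Omega delta].

(* If x is in Omega and y is not in E, then nu delta (x - y) = 0: the values of
   u and v off E do not contribute. *)
Definition energy Omega delta u v : R :=
  2^-1 * \int[(mu \x mu)%E]_(z in ~` (~` Omega `*` ~` Omega))
    ((u z.1 - u z.2) * (v z.1 - v z.2) * nu delta (z.1 - z.2)).

Definition variational_solution Omega delta f g u : Prop :=
  [/\ V_nu Omega delta u,
      V_nu0 Omega delta (fun x => u x - g x) &
      forall v, V_nu0 Omega delta v ->
        energy Omega delta u v = \int[mu]_(x in Omega) (f x * v x)].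

End nonlocal_dirichlet.

(* Main.v *)
Require Import Defs.
From HB Require Import structures.
From mathcomp Require Import all_boot all_order all_algebra.
From mathcomp Require Import all_classical all_reals all_analysis.
From mathcomp Require Import measurable_realfun ring lra.
Import Order.TTheory GRing.Theory Num.Theory.
Import numFieldNormedType.Exports.

Set Implicit Arguments.
Unset Strict Implicit.
Unset Printing Implicit Defensive.

Local Open Scope classical_set_scope.
Local Open Scope ring_scope.

(** The kernel k(x, y) = nu(x - y) is symmetric, takes its values in [0, 1], and the
integral of each k(x, .) is at most a constant M.  By these bounds every square
integrable function has a finite seminorm, so the test functions are, up to null sets,
the square integrable functions that vanish outside Omega.  The theorem is proved for
kernels of this kind on a sigma-finite space, and then applied to the indicator of the
ball.

Green's formula ([green]).  If w vanishes outside Omega, the integrand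
(u(x) - u(y)) (w(x) - w(y)) k(x, y) is the sum of the integrable function
(u(x) - u(y)) w(x) k(x, y) and of its transpose, so that E(u, w) is the integral of
w Lu.  As Lu is square integrable on Omega, with norm at most the square root of M
times the seminorm of u ([sqnorm_nonlocal]), the substitution u = g + w turns the
problem into Lw = f - Lg for an unknown w that vanishes outside Omega.

Poincare's inequality ([poincare]).  Each point x of Omega sees, within the range of
the kernel, a box of fixed volume whose points have a first coordinate smaller by a
fixed amount.  Comparing w(x) with the values of w on that box bounds the mass of w in a
half-space by the seminorm of w and the mass of w in a smaller half-space; as Omega is
bounded, finitely many such steps lead to a half-space that misses Omega, where w
is zero.  Together with Green's formula and Young's inequality this bounds w by
any F such that the pairing of w with Lw is at most its pairing with F ([apriori]);
uniqueness and the stability estimate follow.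

Existence ([solve]).  Write Lw = kappa w - K w, where kappa(x) is the integral of
k(x, .) and K is the integral operator with kernel k.  As K preserves positivity, for
a nonnegative F the iteration kappa W_{n+1} = K W_n + F on Omega, started at 0,
is increasing.  Hence L W_n <= F on Omega, so the a priori bound holds for all W_n with
one constant, and monotone convergence gives a square integrable limit that
solves Lw = F at every point of Omega.  This replaces the Lax-Milgram theorem.  A
general F is the difference of two nonnegative ones. *)

(** * Integrals of real-valued functions *)

(** Measurability of expressions built from measurable functions, indicators and the
ring operations. *)
Ltac mfun := repeat first
  [ assumption | exact: measurable_cst | exact: measurable_id
  | exact: measurable_fst | exact: measurable_snd
  | match goal with
    | H : measurable_fun setT ?u |- measurable_fun setT ?v =>
        match v with (fun _ => u _) => apply: (measurableT_comp H) end
    | H : measurable ?A |- measurable_fun _ \1_?A => exact: measurable_indic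
    | H : measurable ?A |- measurable_fun setT ?v =>
        match v with
        | (fun _ => \1_A _) => apply: (measurableT_comp (measurable_indic _ H))
        end
    end
  | apply: measurable_funM | apply: measurable_funB | apply: measurable_funD
  | apply: measurable_funX | apply: measurableT_comp => //
  | apply: measurable_fun_pair ].

Section nonneg_integrals.
Context d (T : measurableType d) (R : realType).
Variable mu : {measure set T -> \bar R}.
Implicit Types f g : T -> R.

Lemma ge0_le_integral_EFin f g :
  measurable_fun setT f -> measurable_fun setT g ->
  (forall x, 0 <= f x) -> (forall x, f x <= g x) ->
  (\int[mu]_x (f x)%:E <= \int[mu]_x (g x)%:E)%E.
Proof.
move=> mf mg f0 fg; apply: ge0_le_integral => //.
- by move=> x _; rewrite lee_fin.
- exact/measurable_EFinP.
- exact/measurable_EFinP.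
- by move=> x _; rewrite lee_fin.
Qed.

Lemma ge0_integral_cM (a : R) f :
  0 <= a -> measurable_fun setT f -> (forall x, 0 <= f x) ->
  (\int[mu]_x (a * f x)%:E = a%:E * \int[mu]_x (f x)%:E)%E.
Proof.
move=> a0 mf f0; under eq_integral do rewrite EFinM.
rewrite ge0_integralZl//; first exact/measurable_EFinP.
by move=> x _; rewrite lee_fin.
Qed.

Lemma ge0_integral_comb (a b : R) f g :
  0 <= a -> 0 <= b -> measurable_fun setT f -> measurable_fun setT g ->
  (forall x, 0 <= f x) -> (forall x, 0 <= g x) ->
  (\int[mu]_x (a * f x + b * g x)%:E =
   a%:E * \int[mu]_x (f x)%:E + b%:E * \int[mu]_x (g x)%:E)%E.
Proof.
move=> a0 b0 mf mg f0 g0.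
under eq_integral do rewrite EFinD.
rewrite ge0_integralD//; last first.
- by apply/measurable_EFinP; mfun.
- by move=> x _; rewrite lee_fin mulr_ge0.
- by apply/measurable_EFinP; mfun.
- by move=> x _; rewrite lee_fin mulr_ge0.
by rewrite !ge0_integral_cM.
Qed.

Lemma integral_EFin_ge0 f : (forall x, 0 <= f x) ->
  (0 <= \int[mu]_x (f x)%:E)%E.
Proof. by move=> f0; apply: integral_ge0 => x _; rewrite lee_fin. Qed.

Lemma integrable_le f g :
  measurable_fun setT f -> measurable_fun setT g ->
  (forall x, `|f x| <= g x) -> (\int[mu]_x (g x)%:E < +oo)%E ->
  mu.-integrable setT (EFin \o f).
Proof.
move=> mf mg fg goo; apply/integrableP; split; first exact/measurable_EFinP.
apply: le_lt_trans goo.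
by apply: (@ge0_le_integral_EFin (fun x => `|f x|)) => //; mfun.
Qed.

Lemma lty_comb (a b : \bar R) (s t : R) : 0 <= s -> 0 <= t ->
  (0 <= a -> 0 <= b -> a < +oo -> b < +oo -> s%:E * a + t%:E * b < +oo)%E.
Proof.
move=> s0 t0; case: a => [a| |]//; case: b => [b| |]//= _ _ _ _.
by rewrite -!EFinM -EFinD ltry.
Qed.

Lemma integral_EFin_indic f (A : set T) : measurable A ->
  (\int[mu]_(x in A) (f x)%:E = \int[mu]_x (f x * \1_A x)%:E)%E.
Proof.
move=> mA; rewrite integral_mkcond; apply: eq_integral => x _.
rewrite patchE indicE; case: (x \in A) => /=; first by rewrite mulr1.
by rewrite mulr0.
Qed.

End nonneg_integrals.

(** * Integrals over a square *)

Section tonelli.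
Context d (T : measurableType d) (R : realType).
Variable mu : {sigma_finite_measure set T -> \bar R}.
Local Notation mu2 := (mu \x mu)%E.
Implicit Types h : T * T -> R.

Lemma tonelli_xy h : measurable_fun setT h -> (forall z, 0 <= h z) ->
  (\int[mu2]_z (h z)%:E = \int[mu]_x \int[mu]_y (h (x, y))%:E)%E.
Proof.
by move=> mh h0; rewrite (fubini_tonelli1 (EFin \o h))//; exact/measurable_EFinP.
Qed.

Lemma tonelli_yx h : measurable_fun setT h -> (forall z, 0 <= h z) ->
  (\int[mu2]_z (h z)%:E = \int[mu]_y \int[mu]_x (h (x, y))%:E)%E.
Proof.
by move=> mh h0; rewrite (fubini_tonelli2 (EFin \o h))//; exact/measurable_EFinP.
Qed.

Lemma measurable_section h x : measurable_fun setT h ->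
  measurable_fun setT (fun y => h (x, y)).
Proof. by move=> mh; apply: (measurableT_comp mh); exact: pair1_measurable. Qed.

Lemma measurable_integral_section h : measurable_fun setT h ->
  (forall z, 0 <= h z) ->
  measurable_fun setT (fun x => (\int[mu]_y (h (x, y))%:E)%E).
Proof.
move=> mh h0.
by apply: (measurable_fun_fubini_tonelli_F (EFin \o h)) => //; exact/measurable_EFinP.
Qed.

(** No integrability is assumed: the integrals of the positive and negative parts are
measurable, and [fine] of their difference is the real-valued integral. *)
Lemma measurable_Rintegral_section h : measurable_fun setT h ->
  measurable_fun setT (fun x => \int[mu]_y h (x, y)).
Proof.
move=> mh; apply: (measurableT_comp (fine_measurable _)) => //.
pose hp z := Num.max (h z) 0; pose hn z := Num.max (- h z) 0.
have E x : (\int[mu]_y (h (x, y))%:E =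
   \int[mu]_y (hp (x, y))%:E - \int[mu]_y (hn (x, y))%:E)%E.
  rewrite integralE; congr (_ - _)%E; apply: eq_integral => y _ /=.
  - by rewrite funeposE EFin_max.
  - by rewrite funenegE EFin_max.
rewrite (_ : (fun x => _) = fun x => (\int[mu]_y (hp (x, y))%:E -
    \int[mu]_y (hn (x, y))%:E)%E); last by apply/funext => x; exact: E.
have mhn : measurable_fun setT hn.
  by apply: measurable_maxr => //; exact: measurableT_comp.
have mhp : measurable_fun setT hp by apply: measurable_maxr.
apply: emeasurable_funB; apply: measurable_integral_section => // z.
- by rewrite le_max lexx orbT.
- by rewrite le_max lexx orbT.
Qed.

Lemma integrable_prod_swap h :
  mu2.-integrable setT (EFin \o h) ->
  mu2.-integrable setT (EFin \o (fun z => h (z.2, z.1))).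
Proof.
move=> ih; have /measurable_EFinP mh := measurable_int _ ih.
have mhs : measurable_fun setT (fun z : T * T => h (z.2, z.1)).
  by apply: (measurableT_comp mh); mfun.
apply/integrableP; split; first exact/measurable_EFinP.
case/integrableP : ih => _.
have m1 : measurable_fun setT (fun z => `|h z|) by exact: measurableT_comp.
have m2 : measurable_fun setT (fun z : T * T => `|h (z.2, z.1)|).
  exact: measurableT_comp.
rewrite (_ : (\int[mu2]_x _ = \int[mu2]_z (`|h z|)%:E)%E)//.
rewrite [X in _ -> (X < _)%E](_ : _ = \int[mu2]_z (`|h (z.2, z.1)|)%:E)%E//.
by rewrite (tonelli_xy m2)// (tonelli_yx m1).
Qed.

Lemma integral_prod_swap h :
  mu2.-integrable setT (EFin \o h) ->
  (\int[mu2]_z (h (z.2, z.1))%:E = \int[mu2]_z (h z)%:E)%E.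
Proof.
move=> ih; have ihs := integrable_prod_swap ih.
have := integral12_prod_meas1 ih; have := integral21_prod_meas1 ihs.
by rewrite /fubini_F /fubini_G /= => <- <-.
Qed.

End tonelli.

(** * Square integrable functions *)

Section square_integrable.
Context d (T : measurableType d) (R : realType).
Variable mu : {measure set T -> \bar R}.
Implicit Types u v w : T -> R.

Lemma integrable_EFinD v w : mu.-integrable setT (EFin \o v) ->
  mu.-integrable setT (EFin \o w) ->
  mu.-integrable setT (EFin \o (fun x => v x + w x)).
Proof. by move=> iv iw; exact: (integrableD measurableT iv iw). Qed.

Lemma integrable_EFinZ c w : mu.-integrable setT (EFin \o w) ->
  mu.-integrable setT (EFin \o (fun x => c * w x)).
Proof. by move=> iw; exact: (integrableZl measurableT c iw). Qed.

Definition sqnorm w : \bar R := (\int[mu]_x (w x ^+ 2)%:E)%E.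

Lemma sqnorm_ge0 w : (0 <= sqnorm w)%E.
Proof. by apply: integral_EFin_ge0 => x; exact: sqr_ge0. Qed.

Lemma sqnorm_le v w : measurable_fun setT v -> measurable_fun setT w ->
  (forall x, `|v x| <= `|w x|) -> (sqnorm v <= sqnorm w)%E.
Proof.
move=> mv mw vw; apply: ge0_le_integral_EFin; [by mfun|by mfun| |].
- by move=> x; exact: sqr_ge0.
- move=> x; rewrite -(real_normK (num_real (v x))) -(real_normK (num_real (w x))).
  by rewrite ler_sqr ?nnegrE.
Qed.

Lemma sqnormD v w : measurable_fun setT v -> measurable_fun setT w ->
  (sqnorm (fun x => v x + w x)%R <= 2%:E * sqnorm v + 2%:E * sqnorm w)%E.
Proof.
move=> mv mw; rewrite -ge0_integral_comb//; try by [mfun|move=> x; exact: sqr_ge0].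
apply: ge0_le_integral_EFin; [by mfun|by mfun|by move=> x; exact: sqr_ge0|].
move=> x; have := sqr_ge0 (v x - w x); nra.
Qed.

Lemma sqnormD_lty v w : measurable_fun setT v -> measurable_fun setT w ->
  (sqnorm v < +oo -> sqnorm w < +oo -> sqnorm (fun x => v x + w x)%R < +oo)%E.
Proof.
move=> mv mw v2 w2; apply: le_lt_trans (sqnormD mv mw) _.
by apply: lty_comb => //; exact: sqnorm_ge0.
Qed.

Lemma sqnormZ (c : R) w : measurable_fun setT w ->
  (sqnorm (fun x => c * w x)%R = (c ^+ 2)%:E * sqnorm w)%E.
Proof.
move=> mw; rewrite /sqnorm -ge0_integral_cM ?sqr_ge0//; [|by mfun|].
- by apply: eq_integral => x _; rewrite exprMn.
- by move=> x; exact: sqr_ge0.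
Qed.

Lemma sqnormB_lty v w : measurable_fun setT v -> measurable_fun setT w ->
  (sqnorm v < +oo -> sqnorm w < +oo -> sqnorm (fun x => v x - w x)%R < +oo)%E.
Proof.
move=> mv mw v2 w2; have mNw : measurable_fun setT (fun x => - w x).
  exact: measurableT_comp.
apply: (sqnormD_lty mv mNw) => //; apply: le_lt_trans w2.
by apply: sqnorm_le => // x; rewrite normrN.
Qed.

Lemma integrable_mul v w : measurable_fun setT v -> measurable_fun setT w ->
  (sqnorm v < +oo)%E -> (sqnorm w < +oo)%E ->
  mu.-integrable setT (EFin \o (fun x => v x * w x)).
Proof.
move=> mv mw v2 w2.
apply: (@integrable_le _ _ _ _ _ (fun x => 1 * v x ^+ 2 + 1 * w x ^+ 2)).
- by mfun.
- by mfun.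
- move=> x; rewrite ler_norml !mul1r.
  by have := sqr_ge0 (v x - w x); have := sqr_ge0 (v x + w x);
     have := sqr_ge0 (v x); have := sqr_ge0 (w x) => ? ? ? ?; apply/andP; split; nra.
- rewrite ge0_integral_comb//; try by [mfun|move=> x; exact: sqr_ge0].
  by apply: lty_comb => //; exact: sqnorm_ge0.
Qed.

(** Young's inequality is used in place of the Cauchy-Schwarz inequality: the free
parameter lets the quadratic terms be absorbed. *)
Lemma Rintegral_mul_le (e : R) v w : 0 < e ->
  measurable_fun setT v -> measurable_fun setT w ->
  (sqnorm v < +oo)%E -> (sqnorm w < +oo)%E ->
  2 * \int[mu]_x (v x * w x) <= e * fine (sqnorm v) + e^-1 * fine (sqnorm w).
Proof.
move=> e0 mv mw v2 w2.
have ei0 : 0 < e^-1 by rewrite invr_gt0.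
have iv : mu.-integrable setT (EFin \o (fun x => v x ^+ 2)).
  apply: (@integrable_le _ _ _ _ _ (fun x => v x ^+ 2)) => //; [by mfun|by mfun|].
  by move=> x; rewrite ger0_norm// sqr_ge0.
have iw : mu.-integrable setT (EFin \o (fun x => w x ^+ 2)).
  apply: (@integrable_le _ _ _ _ _ (fun x => w x ^+ 2)) => //; [by mfun|by mfun|].
  by move=> x; rewrite ger0_norm// sqr_ge0.
rewrite -!RintegralZl//; last exact: integrable_mul.
rewrite -RintegralD//; [|exact: integrable_EFinZ..].
apply: le_Rintegral => //.
- by apply: integrable_EFinZ; exact: integrable_mul.
- by apply: integrable_EFinD; exact: integrable_EFinZ.
move=> x _; have H : 0 <= e^-1 * (e * v x - w x) ^+ 2.
  by rewrite mulr_ge0 ?sqr_ge0// ltW.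
rewrite -subr_ge0; apply: le_trans H _; rewrite le_eqVlt; apply/orP; left.
by apply/eqP; field; rewrite gt_eqF.
Qed.

End square_integrable.

(** * Symmetric kernels with bounded row integrals *)

Section symmetric_kernel.
Context d (T : measurableType d) (R : realType).
Variable mu : {sigma_finite_measure set T -> \bar R}.
Variables (Om : set T) (k : T * T -> R) (M : R).
Local Notation mu2 := (mu \x mu)%E.
Hypotheses (mOm : measurable Om) (mk : measurable_fun setT k)
  (k0 : forall z, 0 <= k z) (kC : forall x y, k (x, y) = k (y, x))
  (M0 : 0 < M) (kM : forall x, (\int[mu]_y (k (x, y))%:E <= M%:E)%E).
Implicit Types u v w : T -> R.

Let m1Om : measurable_fun setT (\1_Om : T -> R).
Proof. exact: measurable_indic. Qed.

Let mkx x : measurable_fun setT (fun y => k (x, y)).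
Proof. exact: measurable_section. Qed.

Lemma kernel_fst_le (h : T -> R) : measurable_fun setT h -> (forall x, 0 <= h x) ->
  (\int[mu2]_z (h z.1 * k z)%:E <= M%:E * \int[mu]_x (h x)%:E)%E.
Proof.
move=> mh h0; rewrite (tonelli_xy mu (h := fun z => h z.1 * k z))//; last 2 first.
- by mfun.
- by move=> z; rewrite mulr_ge0.
rewrite -ge0_integral_cM//; last exact: ltW.
apply: ge0_le_integral => //.
- by move=> x _; apply: integral_EFin_ge0 => y; rewrite mulr_ge0.
- apply: (@measurable_integral_section _ _ _ mu (fun z => h z.1 * k z)); first by mfun.
  by move=> z; rewrite mulr_ge0.
- by apply/measurable_EFinP; mfun.
- move=> x _ /=; rewrite ge0_integral_cM// muleC EFinM.
  by apply: lee_wpmul2r; rewrite ?lee_fin.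
Qed.

Lemma kernel_snd_le (h : T -> R) : measurable_fun setT h -> (forall x, 0 <= h x) ->
  (\int[mu2]_z (h z.2 * k z)%:E <= M%:E * \int[mu]_x (h x)%:E)%E.
Proof.
move=> mh h0; apply: le_trans (kernel_fst_le mh h0).
rewrite (tonelli_yx mu (h := fun z => h z.2 * k z))//; last 2 first.
- by mfun.
- by move=> z; rewrite mulr_ge0.
rewrite (tonelli_xy mu (h := fun z => h z.1 * k z))//; last 2 first.
- by mfun.
- by move=> z; rewrite mulr_ge0.
rewrite le_eqVlt; apply/orP; left; apply/eqP.
by apply: eq_integral => x _; apply: eq_integral => y _ /=; rewrite kC.
Qed.

Lemma kernel_integrable x : mu.-integrable setT (EFin \o (fun y => k (x, y))).
Proof.
apply: (@integrable_le _ _ _ _ _ (fun y => k (x, y))) => //.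
- by move=> y; rewrite ger0_norm.
- exact: le_lt_trans (kM x) (ltry _).
Qed.

(** Because |a| <= 1 + a^2 and k(x, .) is integrable. *)
Lemma kernel_mul_integrable (a : T -> R) x : measurable_fun setT a ->
  (\int[mu]_y (a y ^+ 2 * k (x, y))%:E < +oo)%E ->
  mu.-integrable setT (EFin \o (fun y => a y * k (x, y))).
Proof.
move=> ma aoo; have mkx' := mkx x.
apply: (@integrable_le _ _ _ _ _ (fun y => 1 * (a y ^+ 2 * k (x, y)) + 1 * k (x, y))).
- by mfun.
- by mfun.
- move=> y; rewrite normrM (ger0_norm (k0 _)) !mul1r -[X in _ + X]mul1r -mulrDl.
  apply: ler_wpM2r => //; rewrite -(real_normK (num_real (a y))).
  have := sqr_ge0 (`|a y| - 1); have := normr_ge0 (a y); nra.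
- rewrite ge0_integral_comb//; [|by mfun|by move=> y; rewrite mulr_ge0 ?sqr_ge0].
  apply: lty_comb => //.
  + by apply: integral_EFin_ge0 => y; rewrite mulr_ge0 ?sqr_ge0.
  + exact: integral_EFin_ge0.
  + exact: le_lt_trans (kM x) (ltry _).
Qed.

(** The Cauchy-Schwarz inequality for the measure k(x, y) dy, of total mass at most M. *)
Lemma kernel_jensen (a : T -> R) x : measurable_fun setT a ->
  (((\int[mu]_y (a y * k (x, y))) ^+ 2)%:E <=
   M%:E * \int[mu]_y (a y ^+ 2 * k (x, y))%:E)%E.
Proof.
move=> ma; have mkx' := mkx x.
have I0 : (0 <= \int[mu]_y (a y ^+ 2 * k (x, y))%:E)%E.
  by apply: integral_EFin_ge0 => y; rewrite mulr_ge0 ?sqr_ge0.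
have [Ioo|] := ltP (\int[mu]_y (a y ^+ 2 * k (x, y))%:E)%E +oo%E; last first.
  by rewrite leye_eq => /eqP ->; rewrite gt0_muley ?lte_fin// leey.
have ia := kernel_mul_integrable ma Ioo.
set L := \int[mu]_y _; set I := (\int[mu]_y _)%E in I0 Ioo *.
have ia2 : mu.-integrable setT (EFin \o (fun y => a y ^+ 2 * k (x, y))).
  apply: (@integrable_le _ _ _ _ _ (fun y => a y ^+ 2 * k (x, y))) => //; [by mfun|by mfun|].
  by move=> y; rewrite ger0_norm// mulr_ge0 ?sqr_ge0.
have K0 : 0 <= \int[mu]_y k (x, y) by apply: Rintegral_ge0.
have KM : \int[mu]_y k (x, y) <= M.
  rewrite -lee_fin /Rintegral fineK; first exact: kM.
  exact: (integrable_fin_num measurableT (kernel_integrable x)).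
(* Expand the square of a - c; the choice c = L / M is optimal. *)
have key c : 2 * c * L <= fine I + c ^+ 2 * M.
  apply: (@le_trans _ _ (fine I + c ^+ 2 * \int[mu]_y k (x, y))); last first.
    by rewrite lerD2l ler_wpM2l// sqr_ge0.
  rewrite -!RintegralZl//; last exact: kernel_integrable.
  have ik := kernel_integrable x.
  rewrite -[fine I]/(\int[mu]_y (a y ^+ 2 * k (x, y))) -RintegralD//; last first.
    exact: integrable_EFinZ.
  apply: le_Rintegral => //.
  - exact: integrable_EFinZ.
  - by apply: integrable_EFinD => //; exact: integrable_EFinZ.
  move=> y _; rewrite mulrA -mulrDl ler_wpM2r//.
  have := sqr_ge0 (a y - c); nra.
rewrite -(@fineK _ I) ?ge0_fin_numE// -EFinM lee_fin.
have := key (L / M); rewrite (_ : 2 * (L / M) * L = 2 * (L ^+ 2 / M)); last by ring.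
rewrite (_ : (L / M) ^+ 2 * M = L ^+ 2 / M); last by field; rewrite gt_eqF.
move=> H; have : L ^+ 2 / M <= fine I by lra.
by rewrite ler_pdivrMr// mulrC.
Qed.

(** The square of the seminorm, as one integral over the square; see
[iterated_seminorm2E] for the iterated integral that defines the energy space. *)
Definition seminorm2 u : \bar R :=
  (\int[mu2]_z ((u z.1 - u z.2) ^+ 2 * k z * \1_Om z.1)%:E)%E.

(** The operator L.  The kernel is bounded, so the principal value is an ordinary
integral. *)
Definition nonlocal u x : R := \int[mu]_y ((u x - u y) * k (x, y)).

Let indOm0 x : 0 <= \1_Om x :> R.
Proof. by rewrite indicE. Qed.

Let indOm1 x : \1_Om x <= 1 :> R.
Proof. by rewrite indicE; case: (_ \in _). Qed.

Let sem0 u z : 0 <= (u z.1 - u z.2) ^+ 2 * k z * \1_Om z.1.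
Proof. by rewrite mulr_ge0// mulr_ge0// sqr_ge0. Qed.

Let semm u : measurable_fun setT u ->
  measurable_fun setT (fun z => (u z.1 - u z.2) ^+ 2 * k z * \1_Om z.1).
Proof. by move=> mu_; mfun. Qed.

Lemma seminorm2_ge0 u : (0 <= seminorm2 u)%E.
Proof. exact: integral_EFin_ge0. Qed.

Lemma seminorm2D u v : measurable_fun setT u -> measurable_fun setT v ->
  (seminorm2 (fun x => u x + v x)%R <= 2%:E * seminorm2 u + 2%:E * seminorm2 v)%E.
Proof.
move=> mu_ mv; rewrite -ge0_integral_comb//; [|exact: semm|exact: semm].
apply: ge0_le_integral_EFin; [by mfun|by mfun|by move=> z; exact: (sem0 (fun x => u x + v x))|].
move=> z; rewrite !mulrA -mulrDl; apply: ler_wpM2r => //.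
rewrite -mulrDl; apply: ler_wpM2r => //.
have := sqr_ge0 (u z.1 - u z.2 - (v z.1 - v z.2)); nra.
Qed.

Lemma seminorm2_sqnorm w : measurable_fun setT w ->
  (seminorm2 w <= (4 * M)%:E * sqnorm mu w)%E.
Proof.
move=> mw; have w0 x : 0 <= w x ^+ 2 by exact: sqr_ge0.
have mw2 : measurable_fun setT (fun x => w x ^+ 2) by mfun.
apply: (@le_trans _ _ (2%:E * \int[mu2]_z (w z.1 ^+ 2 * k z)%:E +
                       2%:E * \int[mu2]_z (w z.2 ^+ 2 * k z)%:E)%E).
  rewrite -ge0_integral_comb//; try by [mfun|move=> z; rewrite mulr_ge0].
  apply: ge0_le_integral_EFin => //; [by mfun|by mfun|].
  move=> z; apply: (@le_trans _ _ ((w z.1 - w z.2) ^+ 2 * k z)).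
    by rewrite ler_piMr// mulr_ge0// sqr_ge0.
  rewrite !mulrA -mulrDl; apply: ler_wpM2r => //.
  have := sqr_ge0 (w z.1 + w z.2); nra.
rewrite (_ : (4 * M)%:E * _ = 2%:E * (M%:E * sqnorm mu w) + 2%:E * (M%:E * sqnorm mu w))%E.
  apply: leeD; apply: lee_wpmul2l; rewrite ?lee_fin//.
  - exact: (kernel_fst_le mw2 w0).
  - exact: (kernel_snd_le mw2 w0).
rewrite -ge0_muleDl ?mule_ge0 ?lee_fin ?sqnorm_ge0 ?ltW//.
by rewrite muleA -EFinD -EFinM; congr (_ * _)%E; congr EFin; ring.
Qed.

Lemma seminorm2_slices u : measurable_fun setT u ->
  seminorm2 u =
  (\int[mu]_x \int[mu]_y ((u x - u y) ^+ 2 * k (x, y) * \1_Om x)%:E)%E.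
Proof. by move=> mu_; rewrite /seminorm2 tonelli_xy//; exact: semm. Qed.

Let slice u x := (\int[mu]_y ((u x - u y) ^+ 2 * k (x, y))%:E)%E.

Let slice_ind u x : Om x ->
  slice u x = (\int[mu]_y ((u x - u y) ^+ 2 * k (x, y) * \1_Om x)%:E)%E.
Proof.
by move=> Ox; apply: eq_integral => y _; rewrite indicE mem_set// mulr1.
Qed.

Lemma ae_slice_lty u : measurable_fun setT u -> (seminorm2 u < +oo)%E ->
  {ae mu, forall x, Om x -> (slice u x < +oo)%E}.
Proof.
move=> mu_ uoo; have iu : mu.-integrable setT
    (fun x => \int[mu]_y ((u x - u y) ^+ 2 * k (x, y) * \1_Om x)%:E)%E.
  apply/integrableP; split.
    by apply: (@measurable_integral_section _ _ _ mu
      (fun z => (u z.1 - u z.2) ^+ 2 * k z * \1_Om z.1)) => //; exact: semm.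
  apply: le_lt_trans uoo; rewrite seminorm2_slices// le_eqVlt; apply/orP; left.
  apply/eqP/eq_integral => x _; rewrite gee0_abs//.
  by apply: integral_EFin_ge0 => y; exact: (sem0 u (x, y)).
have := integrable_ae measurableT iu; apply: filterS => x /(_ I) fx Ox.
by rewrite slice_ind// ltey_eq fx.
Qed.

Lemma nonlocal_integrable u x : measurable_fun setT u -> (slice u x < +oo)%E ->
  mu.-integrable setT (EFin \o (fun y => (u x - u y) * k (x, y))).
Proof.
by move=> mu_ uoo; apply: (@kernel_mul_integrable (fun y => u x - u y)) => //; mfun.
Qed.

(** Finite slices are required because the real-valued integral of a nonintegrable
function is a default value. *)
Lemma nonlocalD u v x : measurable_fun setT u -> measurable_fun setT v ->
  (slice u x < +oo)%E -> (slice v x < +oo)%E ->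
  nonlocal (fun x => u x + v x) x = nonlocal u x + nonlocal v x.
Proof.
move=> mu_ mv uoo voo; rewrite /nonlocal -RintegralD//; [|exact: nonlocal_integrable..].
by apply: eq_Rintegral => y _; ring.
Qed.

Lemma measurable_nonlocal u : measurable_fun setT u ->
  measurable_fun setT (nonlocal u).
Proof.
move=> mu_; apply: (@measurable_Rintegral_section _ _ _ mu
  (fun z => (u z.1 - u z.2) * k z)); by mfun.
Qed.

(** Jensen's inequality on each row.  It also holds at the points where the integral of
the square is infinite. *)
Lemma sqnorm_nonlocal u : measurable_fun setT u ->
  (sqnorm mu (fun x => nonlocal u x * \1_Om x)%R <= M%:E * seminorm2 u)%E.
Proof.
move=> mu_; rewrite seminorm2_slices// -ge0_integralZl//; last 3 first.
- by apply: (@measurable_integral_section _ _ _ mu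
    (fun z => (u z.1 - u z.2) ^+ 2 * k z * \1_Om z.1)) => //; exact: semm.
- by move=> x _; apply: integral_EFin_ge0 => y; exact: (sem0 u (x, y)).
- by rewrite lee_fin ltW.
have mn := measurable_nonlocal mu_.
apply: ge0_le_integral => //.
- by move=> x _; rewrite lee_fin sqr_ge0.
- by apply/measurable_EFinP; mfun.
- apply: measurable_funeM; apply: (@measurable_integral_section _ _ _ mu
    (fun z => (u z.1 - u z.2) ^+ 2 * k z * \1_Om z.1)) => //; exact: semm.
move=> x _; have [Ox|nOx] := pselect (Om x).
  rewrite -slice_ind// indicE mem_set// mulr1.
  by apply: (@kernel_jensen (fun y => u x - u y)); mfun.
rewrite [in leLHS]indicE memNset// mulr0 expr0n/=.
apply: mule_ge0; first by rewrite lee_fin ltW.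
by apply: integral_EFin_ge0 => y; exact: (sem0 u (x, y)).
Qed.

(** * Green's formula *)

Definition energy_form u v : R :=
  2^-1 * \int[mu2]_(z in ~` (~` Om `*` ~` Om))
    ((u z.1 - u z.2) * (v z.1 - v z.2) * k z).

Lemma integrable_mul_nonlocal u w :
  measurable_fun setT u -> measurable_fun setT w ->
  (seminorm2 u < +oo)%E -> (sqnorm mu w < +oo)%E -> (forall x, ~ Om x -> w x = 0) ->
  mu.-integrable setT (EFin \o (fun x => w x * nonlocal u x)).
Proof.
move=> mu_ mw uoo woo w0; have mn := measurable_nonlocal mu_.
rewrite (_ : (fun x => w x * nonlocal u x) =
             (fun x => w x * (nonlocal u x * \1_Om x))); last first.
  apply/funext => x; rewrite indicE; have [Ox|nOx] := pselect (Om x).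
    by rewrite mem_set// mulr1.
  by rewrite w0// !mul0r.
apply: integrable_mul => //; first by mfun.
apply: le_lt_trans (sqnorm_nonlocal mu_) _.
by rewrite lte_mul_pinfty// lee_fin ltW.
Qed.

(** The integrand of E(u, w) is h + h^T with h(x, y) = (u(x) - u(y)) w(x) k(x, y), also
off the domain of integration because w vanishes there.  The function h is integrable
by Young's inequality, so both parts have the same integral, and Fubini's theorem
evaluates it row by row. *)
Lemma green u w :
  measurable_fun setT u -> measurable_fun setT w ->
  (seminorm2 u < +oo)%E -> (sqnorm mu w < +oo)%E -> (forall x, ~ Om x -> w x = 0) ->
  energy_form u w = \int[mu]_x (w x * nonlocal u x).
Proof.
move=> mu_ mw uoo woo w0.
pose h (z : T * T) := (u z.1 - u z.2) * w z.1 * k z.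
have mh : measurable_fun setT h by rewrite /h; mfun.
have ih : mu2.-integrable setT (EFin \o h).
  have msem := semm mu_.
  have mwk : measurable_fun setT (fun z : T * T => w z.1 ^+ 2 * k z) by mfun.
  have wk0 (z : T * T) : 0 <= w z.1 ^+ 2 * k z by rewrite mulr_ge0 ?sqr_ge0.
  have mw2 : measurable_fun setT (fun x => w x ^+ 2) by mfun.
  apply: (@integrable_le _ _ _ _ _ (fun z =>
    1 * ((u z.1 - u z.2) ^+ 2 * k z * \1_Om z.1) + 1 * (w z.1 ^+ 2 * k z))) => //.
  - by mfun.
  - move=> z; rewrite /h !mul1r; have [Oz|nOz] := pselect (Om z.1).
      rewrite indicE mem_set// mulr1 normrM (ger0_norm (k0 _)) -mulrDl.
      apply: ler_wpM2r => //; rewrite ler_norml.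
      have := sqr_ge0 (u z.1 - u z.2 - w z.1).
      have := sqr_ge0 (u z.1 - u z.2 + w z.1).
      have := sqr_ge0 (u z.1 - u z.2); have := sqr_ge0 (w z.1).
      by move=> ? ? ? ?; apply/andP; split; nra.
    by rewrite w0// mulr0 mul0r normr0 addr_ge0 ?(sem0 u)// mulr_ge0 ?sqr_ge0.
  - rewrite (ge0_integral_comb mu2 ler01 ler01 msem mwk (sem0 u) wk0).
    apply: lty_comb => //.
    + exact: seminorm2_ge0.
    + exact: integral_EFin_ge0.
    + apply: (le_lt_trans (kernel_fst_le mw2 (fun x => sqr_ge0 (w x)))).
      
      by rewrite lte_mul_pinfty// lee_fin ltW.
have swE := integral_prod_swap ih.
have ihs : mu2.-integrable setT (EFin \o (fun z => h (z.2, z.1))).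
  exact: integrable_prod_swap.
have split_diff (a b c e q : R) :
  (a - b) * (c - e) * q = (a - b) * c * q + (b - a) * e * q by ring.
have -> : energy_form u w = \int[mu2]_z h z.
  rewrite /energy_form Rintegral_mkcond.
  under eq_Rintegral => z _.
    rewrite (_ : _ z = h z + h (z.2, z.1)); last first.
      rewrite patchE /h /= -(kC z.1 z.2) -surjective_pairing.
      case: ifPn => [_|]; first exact: split_diff.
      rewrite notin_setE => /contrapT[/= n1 n2].
      by rewrite (w0 _ n1) (w0 _ n2) !mulr0 !mul0r addr0.
    over.
  rewrite RintegralD//.
  rewrite [X in _ + X]/Rintegral swE -/(Rintegral mu2 setT h). by field.
rewrite /Rintegral -(integral12_prod_meas1 ih); congr fine.
have mn := measurable_nonlocal mu_.
apply: ae_eq_integral => //.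
- exact: (measurable_fubini_F ih).
- by apply/measurable_EFinP; mfun.
apply: filterS (ae_slice_lty mu_ uoo) => x ux _.
rewrite /fubini_F /h /=; have [Ox|nOx] := pselect (Om x); last first.
  rewrite w0// mul0r; under eq_integral do rewrite mulr0 mul0r.
  exact: integral0.
have ix := nonlocal_integrable mu_ (ux Ox).
rewrite EFinM /nonlocal /Rintegral fineK; last exact: integrable_fin_num.
rewrite -integralZl//; apply: eq_integral => y _ /=.
by rewrite -EFinM; congr EFin; ring.
Qed.

(** The seminorm integrates over the part of the domain of E where x lies in Omega. *)
Lemma energy_form_diag w :
  measurable_fun setT w -> (seminorm2 w < +oo)%E -> (forall x, ~ Om x -> w x = 0) ->
  (sqnorm mu w < +oo)%E -> fine (seminorm2 w) <= 2 * energy_form w w.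
Proof.
move=> mw woo w0 w2; rewrite /energy_form mulrA mulfV// mul1r.
pose G (z : T * T) := (w z.1 - w z.2) ^+ 2 * k z.
have mG : measurable_fun setT G by rewrite /G; mfun.
have G0 z : 0 <= G z by rewrite mulr_ge0 ?sqr_ge0.
rewrite [leRHS](_ : _ = \int[mu2]_z G z); last first.
  rewrite Rintegral_mkcond; apply: eq_Rintegral => z _.
  rewrite patchE /G; case: ifPn => [_|]; first by rewrite expr2.
  rewrite notin_setE => /contrapT[/= n1 n2].
  by rewrite (w0 _ n1) (w0 _ n2) subrr expr0n/= mul0r.
have mw2 : measurable_fun setT (fun x => w x ^+ 2) by mfun.
have Goo : (\int[mu2]_z (G z)%:E < +oo)%E.
  apply: (@le_lt_trans _ _ (2%:E * \int[mu2]_z (w z.1 ^+ 2 * k z)%:E +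
                         2%:E * \int[mu2]_z (w z.2 ^+ 2 * k z)%:E)%E).
    rewrite -ge0_integral_comb//; try by [mfun|move=> z; rewrite mulr_ge0 ?sqr_ge0].
    apply: ge0_le_integral_EFin => //; first by mfun.
    move=> z; rewrite /G !mulrA -mulrDl; apply: ler_wpM2r => //.
    have := sqr_ge0 (w z.1 + w z.2); nra.
  apply: lty_comb => //.
  - by apply: integral_EFin_ge0 => z; rewrite mulr_ge0 ?sqr_ge0.
  - by apply: integral_EFin_ge0 => z; rewrite mulr_ge0 ?sqr_ge0.
  - apply: (le_lt_trans (kernel_fst_le mw2 (fun x => sqr_ge0 (w x)))).
      
    by rewrite lte_mul_pinfty// lee_fin ltW.
  - apply: (le_lt_trans (kernel_snd_le mw2 (fun x => sqr_ge0 (w x)))).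
      
    by rewrite lte_mul_pinfty// lee_fin ltW.
rewrite fine_le ?ge0_fin_numE ?seminorm2_ge0 ?integral_EFin_ge0//.
apply: ge0_le_integral_EFin; [exact: semm|exact: mG|exact: (sem0 w)|].
by move=> z; exact: (ler_piMr (G0 z) (indOm1 z.1)).
Qed.

(** * Poincare's inequality *)

(** The S n are to be thought of as nested half-spaces: a point of S n.+1 sees at least
the kernel mass m0 in S n.  As S 0 misses Omega and S N contains it, N steps of a walk lead
from any point of Omega to a point where test functions vanish. *)
Section walk.
Variables (S : nat -> set T) (N : nat) (m0 : R).
Hypotheses (mS : forall n, measurable (S n)) (m00 : 0 < m0)
  (S0 : forall x, Om x -> ~ S 0%N x) (SN : Om `<=` S N)
  (SS : forall n x, S n.+1 x -> (m0%:E <= \int[mu]_(y in S n) (k (x, y))%:E)%E).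

Let mass w n := (\int[mu]_x (w x ^+ 2 * \1_(S n) x)%:E)%E.

(** Integrate w(x)^2 <= 2 (w(x) - w(y))^2 + 2 w(y)^2 against the kernel, over x in S n.+1
and y in S n. *)
Let mass_step w n : measurable_fun setT w -> (forall x, ~ Om x -> w x = 0) ->
  (m0%:E * mass w n.+1 <= 2%:E * seminorm2 w + 2%:E * (M%:E * mass w n))%E.
Proof.
move=> mw w0.
have mSn := mS n; have mSn1 := mS n.+1.
have i0 i x : 0 <= \1_(S i) x :> R by rewrite indicE.
have i1 i x : \1_(S i) x <= 1 :> R by rewrite indicE; case: (_ \in _).
pose b x := w x ^+ 2 * \1_(S n) x.
have b0 x : 0 <= b x by rewrite mulr_ge0// sqr_ge0.
have mb : measurable_fun setT b by rewrite /b; mfun.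
have msem := semm mw.
have mbk : measurable_fun setT (fun z : T * T => b z.2 * k z) by mfun.
apply: (@le_trans _ _ (2%:E * seminorm2 w + 2%:E * \int[mu2]_z (b z.2 * k z)%:E)%E); last first.
  apply: leeD => //; apply: lee_wpmul2l; rewrite ?lee_fin//.
  exact: (kernel_snd_le mb b0).
have bk0 z : 0 <= b z.2 * k z by rewrite mulr_ge0.
rewrite -(ge0_integral_comb mu2 (ler0n R 2) (ler0n R 2) msem mbk (sem0 w) bk0).
rewrite tonelli_xy//; last 2 first.
- by mfun.
- by move=> z; rewrite addr_ge0// mulr_ge0// (sem0 w).
rewrite -ge0_integral_cM//; last 3 first.
- exact: ltW.
- by mfun.
- by move=> x; rewrite mulr_ge0 ?sqr_ge0.
apply: ge0_le_integral => //.
- by move=> x _; rewrite lee_fin mulr_ge0 ?(ltW m00)// mulr_ge0 ?sqr_ge0.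
- by apply/measurable_EFinP; mfun.
- apply: (@measurable_integral_section _ _ _ mu (fun z =>
    2 * ((w z.1 - w z.2) ^+ 2 * k z * \1_Om z.1) + 2 * (b z.2 * k z))); first by mfun.
  by move=> z; rewrite addr_ge0// mulr_ge0// (sem0 w).
move=> x _.
have rhs0 : (0 <= \int[mu]_y (2 * ((w x - w y) ^+ 2 * k (x, y) * \1_Om x) +
    2 * (b y * k (x, y)))%:E)%E.
  apply: integral_EFin_ge0 => y; apply: addr_ge0; apply: mulr_ge0 => //.
  - exact: (sem0 w (x, y)).
  - exact: (bk0 (x, y)).
have [Ox|nOx] := pselect (Om x); last by rewrite [in leLHS]w0// expr0n/= mul0r mulr0.
have [Sx|nSx] := pselect (S n.+1 x); last first.
  by rewrite [in leLHS]indicE memNset// !mulr0.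
rewrite [\1_(S n.+1) x]indicE mem_set// mulr1 EFinM muleC.
apply: (@le_trans _ _ ((w x ^+ 2)%:E * \int[mu]_y (k (x, y) * \1_(S n) y)%:E)%E).
  apply: lee_wpmul2l; first by rewrite lee_fin sqr_ge0.
  by rewrite -integral_EFin_indic//; exact: SS.
have mkx' := mkx x.
rewrite -ge0_integral_cM ?sqr_ge0//; [|by mfun|by move=> y; rewrite mulr_ge0].
apply: ge0_le_integral_EFin.
- by mfun.
- by mfun.
- by move=> y; rewrite mulr_ge0 ?sqr_ge0// mulr_ge0.
move=> y; rewrite /b [\1_Om x]indicE mem_set// mulr1.
rewrite [\1_(S n) y]indicE; case: (y \in S n); rewrite /= ?(mulr0, mul0r, mulr1, addr0).
  rewrite !mulrA -mulrDl; apply: ler_wpM2r => //.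
  have := sqr_ge0 (w x - w y - w y); nra.
by rewrite mulr_ge0// mulr_ge0// sqr_ge0.
Qed.

Lemma poincare : exists2 P : R, 0 < P &
  forall w, measurable_fun setT w -> (forall x, ~ Om x -> w x = 0) ->
    (sqnorm mu w <= P%:E * seminorm2 w)%E.
Proof.
have [P P0 HP] : exists2 P : R, 0 < P &
  forall w, measurable_fun setT w -> (forall x, ~ Om x -> w x = 0) ->
    (mass w N <= P%:E * seminorm2 w)%E.
  elim: N => [|n [P P0 HP]].
    exists 1 => // w mw w0; rewrite /mass.
    rewrite (_ : (\int[mu]_x _)%E = 0%E) ?mul1e ?seminorm2_ge0//.
    apply: integral0_eq => x _; rewrite indicE.
    have [Ox|nOx] := pselect (Om x); last by rewrite w0// expr0n mul0r.
    by rewrite memNset ?mulr0//; exact: S0.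
  have c0 : 0 < 2 + 2 * (M * P) by rewrite addr_gt0// mulr_gt0// mulr_gt0.
  exists (m0^-1 * (2 + 2 * (M * P))); first by rewrite mulr_gt0// invr_gt0.
  move=> w mw w0; have := mass_step n mw w0.
  rewrite EFinM -muleA -lee_pdivrMl//; last by rewrite invr_gt0.
  rewrite invrK => /le_trans; apply.
  rewrite (EFinD 2 (2 * (M * P))) ge0_muleDl; [|by rewrite lee_fin|]; last first.
    by rewrite lee_fin mulr_ge0// mulr_ge0// ltW.
  apply: leeD => //; rewrite EFinM -muleA; apply: lee_wpmul2l; first by rewrite lee_fin.
  rewrite EFinM -muleA; apply: lee_wpmul2l; first by rewrite lee_fin ltW.
  exact: HP.
exists P => // w mw w0; apply: le_trans (HP w mw w0).
rewrite le_eqVlt; apply/orP; left; apply/eqP/eq_integral => x _.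
rewrite indicE; have [Ox|nOx] := pselect (Om x); last by rewrite w0// expr0n mul0r.
by rewrite mem_set ?mulr1//; exact: SN.
Qed.

(** A point of Omega lies in S N, and N is not 0. *)
Lemma kernel_row_ge x : Om x -> m0 <= \int[mu]_y k (x, y).
Proof.
move=> Ox; rewrite -lee_fin /Rintegral fineK; last first.
  exact: integrable_fin_num (kernel_integrable x).
have : S N x by exact: SN.
case: N => [/(S0 Ox)//|n Sx]; apply: le_trans (SS Sx) _.
apply: ge0_subset_integral.
- exact: mS.
- by [].
- by apply/measurable_EFinP; exact: mkx.
- by move=> y _; rewrite lee_fin.
- by [].
Qed.

(** * A priori estimate *)

(** The squared seminorm s of w is at most twice the pairing of w with Lw, hence twice
that of w with F.  With P the Poincare constant, Young's inequality with parameter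
1 / (2 P) bounds the latter by s / 2 + 2 P |F|^2, and s / 2 is absorbed. *)
Lemma apriori : exists2 C : R, 0 < C &
  forall w F, measurable_fun setT w -> measurable_fun setT F ->
    (forall x, ~ Om x -> w x = 0) -> (sqnorm mu w < +oo)%E -> (sqnorm mu F < +oo)%E ->
    \int[mu]_x (w x * nonlocal w x) <= \int[mu]_x (w x * F x) ->
    (sqnorm mu w <= C%:E * sqnorm mu F)%E /\ (seminorm2 w <= C%:E * sqnorm mu F)%E.
Proof.
have [P P0 HP] := poincare; exists (4 * P + 4 * P ^+ 2).
  by rewrite addr_gt0// mulr_gt0// exprn_gt0.
move=> w F mw mF w0 w2 F2 wF.
have soo : (seminorm2 w < +oo)%E.
  apply: le_lt_trans (seminorm2_sqnorm mw) _.
  by rewrite lte_mul_pinfty// lee_fin mulr_ge0 ?ltW.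
have sfin : seminorm2 w \is a fin_num by rewrite ge0_fin_numE// seminorm2_ge0.
have qfin : sqnorm mu w \is a fin_num by rewrite ge0_fin_numE// sqnorm_ge0.
have ffin : sqnorm mu F \is a fin_num by rewrite ge0_fin_numE// sqnorm_ge0.
have := HP w mw w0; have := energy_form_diag mw soo w0 w2.
rewrite (green mw mw soo w2 w0).
have i2P : 0 < (2 * P)^-1 by rewrite invr_gt0 mulr_gt0.
have := Rintegral_mul_le i2P mw mF w2 F2; rewrite invrK.
have := fine_ge0 (sqnorm_ge0 mu F).
rewrite -(fineK sfin) -(fineK qfin) -(fineK ffin) -!EFinM !lee_fin /=.
set s := fine (seminorm2 w); set q := fine (sqnorm mu w).
set f := fine (sqnorm mu F) => f0 young diag qs.
have h1 : (2 * P)^-1 * q <= 2^-1 * s.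
  rewrite invfM -mulrA ler_pM2l ?invr_gt0//.
  by rewrite ler_pdivrMl.
have sf : s <= 4 * P * f by move: h1 young diag wF; lra.
have P20 : 0 <= P ^+ 2 * f by rewrite mulr_ge0 ?sqr_ge0.
have Pf0 : 0 <= P * f by rewrite mulr_ge0 ?(ltW P0).
rewrite mulrDl -!(mulrA 4); split.
  apply: le_trans qs _; apply: le_trans (ler_wpM2l (ltW P0) sf) _.
  rewrite (_ : P * _ = 4 * (P ^+ 2 * f)); last by ring.
  by rewrite lerDr mulr_ge0.
by apply: le_trans sf _; rewrite -mulrA lerDl mulr_ge0.
Qed.

(** * Solving Lw = F by monotone iteration *)

Section solve.
Hypothesis k1 : forall z, k z <= 1.

Definition average w x : R := \int[mu]_y (w y * k (x, y)).

Let kernel_sq_le w x : measurable_fun setT w ->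
  (\int[mu]_y (w y ^+ 2 * k (x, y))%:E <= sqnorm mu w)%E.
Proof.
move=> mw; have mkx' := mkx x; apply: ge0_le_integral_EFin; [by mfun|by mfun| |] => y.
- by rewrite mulr_ge0 ?sqr_ge0.
- by rewrite ler_piMr ?sqr_ge0.
Qed.

Lemma average_integrable w x : measurable_fun setT w -> (sqnorm mu w < +oo)%E ->
  mu.-integrable setT (EFin \o (fun y => w y * k (x, y))).
Proof.
move=> mw w2; apply: kernel_mul_integrable => //.
exact: le_lt_trans (kernel_sq_le x mw) w2.
Qed.

Lemma nonlocal_average w x : measurable_fun setT w -> (sqnorm mu w < +oo)%E ->
  nonlocal w x = (\int[mu]_y k (x, y)) * w x - average w x.
Proof.
move=> mw w2; rewrite mulrC -RintegralZl//; last exact: kernel_integrable.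
rewrite -RintegralB//; [|exact: integrable_EFinZ (kernel_integrable x)
                        |exact: average_integrable].
by apply: eq_Rintegral => y _; rewrite mulrBl.
Qed.

(** Schur's test: both marginals of the kernel are bounded by M. *)
Lemma sqnorm_average w : measurable_fun setT w ->
  (sqnorm mu (average w) <= (M * M)%:E * sqnorm mu w)%E.
Proof.
move=> mw; have mw2 : measurable_fun setT (fun y => w y ^+ 2) by mfun.
have m1 : measurable_fun setT (fun z : T * T => w z.2 ^+ 2 * k z) by mfun.
have g0 (z : T * T) : 0 <= w z.2 ^+ 2 * k z by rewrite mulr_ge0 ?sqr_ge0.
have M0' : 0 <= M by exact: ltW.
apply: (@le_trans _ _ (M%:E * \int[mu2]_z (w z.2 ^+ 2 * k z)%:E)%E); last first.
  rewrite EFinM -muleA; apply: lee_wpmul2l; first by rewrite lee_fin.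
  by apply: (kernel_snd_le mw2) => x; exact: sqr_ge0.
rewrite tonelli_xy// -ge0_integralZl//; last 2 first.
- exact: (@measurable_integral_section _ _ _ mu _ m1 g0).
- by move=> x _; apply: integral_EFin_ge0 => y; exact: (g0 (x, y)).
apply: ge0_le_integral => //.
- by move=> x _; rewrite lee_fin sqr_ge0.
- apply/measurable_EFinP; apply: measurable_funX.
  by apply: (@measurable_Rintegral_section _ _ _ mu (fun z => w z.2 * k z)); mfun.
- by apply: measurable_funeM; exact: (@measurable_integral_section _ _ _ mu _ m1 g0).
- by move=> x _; exact: kernel_jensen.
Qed.

Lemma measurable_average w : measurable_fun setT w ->
  measurable_fun setT (average w).
Proof.
move=> mw.
by apply: (@measurable_Rintegral_section _ _ _ mu (fun z => w z.2 * k z)); mfun.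
Qed.

Lemma average_le v w x : measurable_fun setT v -> measurable_fun setT w ->
  (sqnorm mu v < +oo)%E -> (sqnorm mu w < +oo)%E ->
  (forall y, v y <= w y) -> average v x <= average w x.
Proof.
move=> mv mw v2 w2 vw; apply: le_Rintegral => //; [exact: average_integrable..|].
by move=> y _; apply: ler_wpM2r.
Qed.

Section iteration.
Variable F : T -> R.
Hypotheses (mF : measurable_fun setT F) (F2 : (sqnorm mu F < +oo)%E)
  (F0 : forall x, 0 <= F x).

Let row x := \int[mu]_y k (x, y).

Let mrow : measurable_fun setT row.
Proof. exact: measurable_Rintegral_section. Qed.

Let row_gt0 x : Om x -> 0 < row x.
Proof. by move=> /kernel_row_ge; exact: lt_le_trans. Qed.

Definition jacobi_step w x : R := (average w x + F x) / row x * \1_Om x.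

Definition jacobi n : T -> R := iter n jacobi_step (cst 0).

Let good w := [/\ measurable_fun setT w, (sqnorm mu w < +oo)%E & forall x, 0 <= w x].

Let average_ge0 w x : (forall y, 0 <= w y) -> 0 <= average w x.
Proof. by move=> w0; apply: Rintegral_ge0 => y _; rewrite mulr_ge0. Qed.

Let step_good w : good w -> good (jacobi_step w).
Proof.
move=> [mw w2 w0]; have ma := measurable_average mw.
have mi : measurable_fun setT (fun x => (row x)^-1).
  rewrite (_ : (fun x => _) = fun x => row x `^ (-1)).
    exact: (measurableT_comp (measurable_powR _) mrow).
  by apply/funext => x; rewrite powR_inv1//; exact: Rintegral_ge0.
have ms : measurable_fun setT (jacobi_step w) by rewrite /jacobi_step; mfun.
split=> //; last first.
  move=> x; rewrite /jacobi_step mulr_ge0// mulr_ge0 ?addr_ge0// ?average_ge0//.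
  by rewrite invr_ge0; apply: Rintegral_ge0.
apply: (@le_lt_trans _ _ (sqnorm mu (fun x => m0^-1 * (average w x + F x)))).
  apply: sqnorm_le => //; first by mfun.
  move=> x; rewrite /jacobi_step indicE.
  have [Ox|nOx] := pselect (Om x); last by rewrite memNset// mulr0 normr0.
  have aF : 0 <= average w x + F x by rewrite addr_ge0// average_ge0.
  rewrite mem_set// mulr1 !normrM (ger0_norm aF) mulrC; apply: ler_wpM2r => //.
  rewrite !ger0_norm ?invr_ge0 ?(ltW m00) ?(ltW (row_gt0 Ox))//.
  by rewrite lef_pV2 ?posrE ?row_gt0//; exact: kernel_row_ge.
rewrite sqnormZ; last by mfun.
rewrite lte_mul_pinfty ?lee_fin ?sqr_ge0//.
apply: sqnormD_lty => //; apply: le_lt_trans (sqnorm_average mw) _.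
by rewrite lte_mul_pinfty ?lee_fin ?mulr_ge0// ltW.
Qed.

Let jacobi_good n : good (jacobi n).
Proof.
elim: n => [|n ih]; last exact: step_good.
split=> //=; rewrite /sqnorm; under eq_integral do rewrite expr0n/=.
by rewrite integral0 ltry.
Qed.

Let jacobi_out n x : ~ Om x -> jacobi n x = 0.
Proof. by case: n => [//|n] nOx /=; rewrite /jacobi_step indicE memNset// mulr0. Qed.

Let jacobiS n x : Om x -> row x * jacobi n.+1 x = average (jacobi n) x + F x.
Proof.
move=> Ox; rewrite /= /jacobi_step indicE mem_set// mulr1 mulrC divfK//.
by rewrite gt_eqF// row_gt0.
Qed.

Let jacobi_le n x : jacobi n x <= jacobi n.+1 x.
Proof.
elim: n x => [|n ih] x; first by have [_ _ + ] := jacobi_good 1; exact.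
have [Ox|nOx] := pselect (Om x); last by rewrite !jacobi_out.
rewrite -(ler_pM2l (row_gt0 Ox)) !jacobiS// lerD2r.
have [m1 n1 _] := jacobi_good n; have [m2 n2 _] := jacobi_good n.+1.
exact: average_le.
Qed.

Let jacobi_nd x : nondecreasing_seq (fun n => jacobi n x).
Proof. by apply/nondecreasing_seqP => n; exact: jacobi_le. Qed.

(** On Omega, kappa W_n - K W_n <= kappa W_{n+1} - K W_n = F, so that the a priori
estimate applies to every iterate. *)
Let jacobi_bound : exists2 B : R, 0 <= B & forall n, (sqnorm mu (jacobi n) <= B%:E)%E.
Proof.
have [C C0 HC] := apriori.
exists (C * fine (sqnorm mu F)).
  by rewrite mulr_ge0 ?(ltW C0)// fine_ge0// sqnorm_ge0.
move=> n; rewrite EFinM fineK; last by rewrite ge0_fin_numE// sqnorm_ge0.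
have [mw w2 w0] := jacobi_good n.
have soo : (seminorm2 (jacobi n) < +oo)%E.
  apply: le_lt_trans (seminorm2_sqnorm mw) _.
  by rewrite lte_mul_pinfty// lee_fin mulr_ge0 ?ltW.
apply: (HC _ _ mw mF (jacobi_out n) w2 F2 _).1.
apply: le_Rintegral => //.
- exact: (integrable_mul_nonlocal mw mw soo w2 (jacobi_out n)).
- exact: integrable_mul.
move=> x _; have [Ox|nOx] := pselect (Om x); last by rewrite jacobi_out// !mul0r.
apply: ler_wpM2l => //; rewrite nonlocal_average// lerBlDl -jacobiS//.
by rewrite ler_pM2l ?row_gt0//; exact: jacobi_le.
Qed.

Let limit x := limn (fun n => jacobi n x).

(** By [kernel_jensen] and k <= 1, the square of K W_n at any point is at most M times the
squared L^2 norm of W_n; so the iterates are bounded, and converge, at every point. *)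
Let jacobi_cvg x : (fun n => jacobi n x) @ \oo --> limit x.
Proof.
have [B B0 HB] := jacobi_bound.
have [Ox|nOx] := pselect (Om x); last first.
  rewrite /limit (_ : (fun n => jacobi n x) = cst 0); last first.
    by apply/funext => n; rewrite jacobi_out.
  by rewrite lim_cst//; exact: cvg_cst.
apply: nondecreasing_is_cvgn; first exact: jacobi_nd.
exists ((row x)^-1 * (1 + M * B + F x)) => _ [n _ <-].
apply: le_trans (jacobi_le n x) _.
rewrite ler_pdivlMl ?row_gt0// jacobiS// lerD2r.
have [mw w2 w0] := jacobi_good n.
have a0 : 0 <= average (jacobi n) x by exact: average_ge0.
have : (average (jacobi n) x) ^+ 2 <= M * B.
  rewrite -lee_fin; apply: le_trans (kernel_jensen x mw) _.
  rewrite EFinM; apply: lee_wpmul2l; first by rewrite lee_fin ltW.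
  exact: le_trans (kernel_sq_le x mw) (HB n).
have := sqr_ge0 (average (jacobi n) x - 1); nra.
Qed.

Lemma solve_ge0 : exists w, [/\ measurable_fun setT w, (sqnorm mu w < +oo)%E,
  (forall x, ~ Om x -> w x = 0) & forall x, Om x -> nonlocal w x = F x].
Proof.
have [B B0 HB] := jacobi_bound.
have ml : measurable_fun setT limit.
  apply: (@measurable_fun_cvg _ _ _ setT jacobi) => [n|x _].
    by have [] := jacobi_good n.
  exact: jacobi_cvg.
(* One form of monotone convergence serves for the squares and for the averages. *)
have mct (phi : R -> T -> R) : 
    (forall n, measurable_fun setT (fun x => phi (jacobi n x) x)) ->
    (forall a y, 0 <= a -> 0 <= phi a y) ->
    (forall a b y, 0 <= a -> a <= b -> phi a y <= phi b y) ->
    (forall y, (fun n => phi (jacobi n y) y) @ \oo --> phi (limit y) y) ->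
    ((fun n => \int[mu]_y (phi (jacobi n y) y)%:E) @ \oo -->
     \int[mu]_y (phi (limit y) y)%:E)%E.
  move=> mphi phi0 phi_le phi_cvg.
  rewrite (_ : (\int[mu]_y (phi (limit y) y)%:E)%E =
    (\int[mu]_y limn (fun n => (phi (jacobi n y) y)%:E))%E); last first.
    apply: eq_integral => y _; apply/esym/cvg_lim => //.
    by apply: cvg_EFin; [exact: nearW|exact: phi_cvg].
  apply: cvg_monotone_convergence => //.
  - by move=> n; apply/measurable_EFinP.
  - by move=> n y _; rewrite lee_fin phi0//; have [_ _] := jacobi_good n.
  - move=> y _ a b ab; rewrite lee_fin phi_le//; last exact: jacobi_nd.
    by have [_ _] := jacobi_good a.
have l2 : (sqnorm mu limit <= B%:E)%E.
  have : ((fun n => sqnorm mu (jacobi n)) @ \oo --> sqnorm mu limit)%E.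
    apply: (mct (fun a _ => a ^+ 2)).
    - by move=> n; have [] := jacobi_good n => *; mfun.
    - by move=> a _ _; exact: sqr_ge0.
    - by move=> a b _ a0 ab; rewrite ler_sqr ?nnegrE// (le_trans a0).
    - by move=> y; rewrite expr2; apply: cvgM; exact: jacobi_cvg.
  move=> /cvg_lim <-//; apply: lime_le; last exact: nearW.
  apply: ereal_nondecreasing_is_cvgn; apply/nondecreasing_seqP => n.
  have [m1 _ p1] := jacobi_good n; have [m2 _ p2] := jacobi_good n.+1.
  by apply: sqnorm_le => // x; rewrite !ger0_norm//; exact: jacobi_le.
have l2oo := le_lt_trans l2 (ltry B).
exists limit; split=> //.
- move=> x nOx; rewrite /limit (_ : (fun n => jacobi n x) = cst 0) ?lim_cst//.
  by apply/funext => n; rewrite jacobi_out.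
move=> x Ox; rewrite nonlocal_average// -/(row x).
suff -> : row x * limit x = average limit x + F x by rewrite addrC addKr.
have acvg : average (jacobi n) x @[n --> \oo] --> average limit x.
  apply: fine_cvg; rewrite /average /Rintegral fineK; last first.
    exact: integrable_fin_num (average_integrable x ml l2oo).
  have mkx' := mkx x.
  apply: (mct (fun a y => a * k (x, y))).
  - by move=> n; have [] := jacobi_good n => *; mfun.
  - by move=> a y a0; rewrite mulr_ge0.
  - by move=> a b y _ ab; rewrite ler_wpM2r.
  - by move=> y; apply: cvgM; [exact: jacobi_cvg|exact: cvg_cst].
have c1 : row x * jacobi n.+1 x @[n --> \oo] --> row x * limit x.
  apply: cvgM; first exact: cvg_cst.
  have := @jacobi_cvg x; rewrite -(@cvg_shiftS _ (fun n => jacobi n x)).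
  by [].
have c2 : row x * jacobi n.+1 x @[n --> \oo] --> average limit x + F x.
  under eq_fun do rewrite jacobiS//.
  by apply: cvgD => //; exact: cvg_cst.
exact: cvg_unique c1 c2.
Qed.

End iteration.

Lemma solve F : measurable_fun setT F -> (sqnorm mu F < +oo)%E ->
  exists w, [/\ measurable_fun setT w, (sqnorm mu w < +oo)%E,
    (forall x, ~ Om x -> w x = 0) & forall x, Om x -> nonlocal w x = F x].
Proof.
move=> mF F2.
pose Fp x := Num.max (F x) 0; pose Fn x := Num.max (- F x) 0.
have mFp : measurable_fun setT Fp by exact: measurable_maxr.
have mFn : measurable_fun setT Fn.
  by apply: measurable_maxr => //; exact: measurableT_comp.
have Fp0 x : 0 <= Fp x by rewrite le_max lexx orbT.
have Fn0 x : 0 <= Fn x by rewrite le_max lexx orbT.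
have Fp2 : (sqnorm mu Fp < +oo)%E.
  apply: le_lt_trans F2; apply: sqnorm_le => // x.
  by rewrite ger0_norm// ge_max ler_norm normr_ge0.
have Fn2 : (sqnorm mu Fn < +oo)%E.
  apply: le_lt_trans F2; apply: sqnorm_le => // x.
  by rewrite ger0_norm// ge_max -normrN ler_norm normr_ge0.
have [a [ma a2 a0 La]] := solve_ge0 mFp Fp2 Fp0.
have [b [mb b2 b0 Lb]] := solve_ge0 mFn Fn2 Fn0.
have mab : measurable_fun setT (fun x => a x - b x) by mfun.
exists (fun x => a x - b x); split=> //.
- exact: sqnormB_lty.
- by move=> x nOx; rewrite a0// b0// subrr.
move=> x Ox; have ab2 := sqnormB_lty ma mb a2 b2.
have ia := average_integrable x ma a2; have ib := average_integrable x mb b2.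
have aE : average (fun x => a x - b x) x = average a x - average b x.
  rewrite /average -RintegralB//.
  by apply: eq_Rintegral => y _; rewrite mulrBl.
have := La x Ox; have := Lb x Ox; rewrite !nonlocal_average// aE /Fp /Fn => eb ea.
have -> : F x = Num.max (F x) 0 - Num.max (- F x) 0.
  by rewrite /Order.max; case: ltP => h1; case: ltP => h2; lra.
by rewrite -ea -eb; ring.
Qed.

(** * Dependence on almost everywhere classes *)

Lemma ae_prod (P : T -> Prop) : {ae mu, forall x, P x} ->
  {ae mu2, forall z, P z.1 /\ P z.2}.
Proof.
move=> [A [mA A0 PA]].
have null1 : mu2.-negligible (A `*` setT).
  exists (A `*` setT); split=> //; first exact: measurableX.
  by rewrite product_measure1E// [X in (X * _)%E]A0 mul0e.
have null2 : mu2.-negligible (setT `*` A).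
  exists (setT `*` A); split=> //; first exact: measurableX.
  by rewrite product_measure1E// [X in (_ * X)%E]A0 mule0.
apply: negligibleS (negligibleU null1 null2) => z /= /not_andP[nP|nP].
- by left; split=> //; exact: PA.
- by right; split=> //; exact: PA.
Qed.

Lemma seminorm2_ae u v : measurable_fun setT u -> measurable_fun setT v ->
  {ae mu, forall x, u x = v x} -> seminorm2 u = seminorm2 v.
Proof.
move=> mu_ mv uv; apply: ge0_ae_eq_integral => //.
- by apply/measurable_EFinP; exact: semm.
- by apply/measurable_EFinP; exact: semm.
- by move=> z _; rewrite lee_fin (sem0 u).
- by move=> z _; rewrite lee_fin (sem0 v).
by apply: filterS (ae_prod uv) => z [-> ->].
Qed.

Lemma energy_form_ae u u' v v' :
  measurable_fun setT u -> measurable_fun setT u' ->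
  measurable_fun setT v -> measurable_fun setT v' ->
  {ae mu, forall x, u x = u' x} -> {ae mu, forall x, v x = v' x} ->
  energy_form u v = energy_form u' v'.
Proof.
move=> mu_ mu' mv mv' uu vv; rewrite /energy_form /Rintegral; congr (_ * fine _).
have mD : measurable (~` (~` Om `*` ~` Om) : set (T * T)).
  by apply: measurableC; apply: measurableX; exact: measurableC.
apply: ae_eq_integral => //.
- by apply/measurable_EFinP; apply: measurable_funTS; mfun.
- by apply/measurable_EFinP; apply: measurable_funTS; mfun.
by apply: filterS2 (ae_prod uu) (ae_prod vv) => z [-> ->] [-> ->].
Qed.

(** * The weak problem *)

(** Co is the collar on which the Dirichlet datum is prescribed; a point of Omega does not
see beyond E, the union of Omega and Co. *)
Section weak_problem.
Variable Co : set T.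
Hypotheses (mCo : measurable Co) (OmCo : forall x, Co x -> ~ Om x)
  (kE : forall x y, Om x -> ~ (Om `|` Co) y -> k (x, y) = 0).
Local Notation E := (Om `|` Co).

Let mE : measurable E. Proof. exact: measurableU. Qed.

Definition L2_on u : Prop :=
  measurable_fun Om u /\ (\int[mu]_(x in Om) (u x ^+ 2)%:E < +oo)%E.

Definition iterated_seminorm2 u : \bar R :=
  (\int[mu]_(x in Om) \int[mu]_(y in E) ((u x - u y) ^+ 2 * k (x, y))%:E)%E.

Definition energy_space u : Prop :=
  [/\ measurable_fun E u, L2_on u & (iterated_seminorm2 u < +oo)%E].

Definition test_space u : Prop :=
  energy_space u /\ u = cst 0 %[ae mu in Co].

Definition weak_solution f g u : Prop :=
  [/\ energy_space u, test_space (fun x => u x - g x) &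
      forall v, test_space v ->
        energy_form u v = \int[mu]_(x in Om) (f x * v x)].

(** Functions in the energy space are measurable only on E; their extension by 0 has
the same energy and seminorm. *)
Let onE u : T -> R := u \_ E.
Let onOm u x : R := u x * \1_Om x.

Let onE_in u x : E x -> onE u x = u x.
Proof. by move=> Ex; rewrite /onE patchE mem_set. Qed.

Let onE_out u x : ~ E x -> onE u x = 0.
Proof. by move=> Ex; rewrite /onE patchE memNset. Qed.

Let onOm_in u x : Om x -> onOm u x = u x.
Proof. by move=> Ox; rewrite /onOm indicE mem_set// mulr1. Qed.

Let onOm_out u x : ~ Om x -> onOm u x = 0.
Proof. by move=> Ox; rewrite /onOm indicE memNset// mulr0. Qed.

Let monE u : measurable_fun E u -> measurable_fun setT (onE u).
Proof. by move=> mu_; apply/(measurable_restrictT _ mE). Qed.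

Let monOm u : measurable_fun Om u -> measurable_fun setT (onOm u).
Proof.
move=> mu_; rewrite (_ : onOm u = u \_ Om); first exact/(measurable_restrictT _ mOm).
apply/funext => x; rewrite patchE; have [Ox|nOx] := pselect (Om x).
  by rewrite onOm_in// mem_set.
by rewrite onOm_out// memNset.
Qed.

Let sqnorm_onOm u : sqnorm mu (onOm u) = (\int[mu]_(x in Om) (u x ^+ 2)%:E)%E.
Proof.
rewrite integral_EFin_indic//; apply: eq_integral => x _; congr EFin.
rewrite /onOm indicE; have [Ox|nOx] := pselect (Om x).
  by rewrite mem_set// !mulr1.
by rewrite memNset// !mulr0 expr0n.
Qed.

Lemma iterated_seminorm2E u : measurable_fun E u ->
  iterated_seminorm2 u = seminorm2 (onE u).
Proof.
move=> /monE mu_; rewrite seminorm2_slices// /iterated_seminorm2 integral_mkcond.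
apply: eq_integral => x _; rewrite patchE.
have [Ox|nOx] := pselect (Om x); last first.
  rewrite memNset// [RHS]integral0_eq// => y _.
  by rewrite indicE memNset// mulr0.
rewrite mem_set// integral_mkcond; apply: eq_integral => y _.
rewrite patchE indicE (mem_set Ox) mulr1 (onE_in u (or_introl Ox)).
have [Ey|nEy] := pselect (E y); first by rewrite mem_set// onE_in.
by rewrite memNset// kE// mulr0.
Qed.

Let energy_onE u v : energy_form u v = energy_form (onE u) (onE v).
Proof.
rewrite /energy_form; congr (_ * _); apply: eq_Rintegral => z; rewrite inE => Dz.
have [Oz1|nOz1] := pselect (Om z.1).
  have [E2|nE2] := pselect (E z.2).
    by rewrite !onE_in//; left.
  have kz : k z = 0 by rewrite [z]surjective_pairing kE.
  by rewrite kz !mulr0.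
have Oz2 : Om z.2 by apply: contrapT => nOz2; exact: Dz.
have [E1|nE1] := pselect (E z.1).
  by rewrite !onE_in//; left.
have kz : k z = 0 by rewrite [z]surjective_pairing kC kE.
by rewrite kz !mulr0.
Qed.

(** The test functions, up to null sets: compare [nice_test] and [test_nice]. *)
Let nice w := [/\ measurable_fun setT w, (sqnorm mu w < +oo)%E &
                  forall x, ~ Om x -> w x = 0].

Let nice_seminorm2 w : nice w -> (seminorm2 w < +oo)%E.
Proof.
move=> [mw w2 _]; apply: le_lt_trans (seminorm2_sqnorm mw) _.
by rewrite lte_mul_pinfty// lee_fin mulr_ge0 ?ltW.
Qed.

Let onE_nice w : nice w -> onE w = w.
Proof.
move=> [_ _ w0]; apply/funext => x; have [Ex|nEx] := pselect (E x).
  by rewrite onE_in.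
by rewrite onE_out// w0// => Ox; apply: nEx; left.
Qed.

Let onOm_nice w : nice w -> onOm w = w.
Proof.
move=> [_ _ w0]; apply/funext => x; have [Ox|nOx] := pselect (Om x).
  by rewrite onOm_in.
by rewrite onOm_out// w0.
Qed.

Let nice_test w : nice w -> test_space w.
Proof.
move=> nw; have [mw w2 w0] := nw; split.
  split.
  - exact: measurable_funTS.
  - split; first exact: measurable_funTS.
    by rewrite -sqnorm_onOm onOm_nice.
  - rewrite iterated_seminorm2E; last exact: measurable_funTS.
    by rewrite onE_nice//; exact: nice_seminorm2.
by apply: aeW => x Cx /=; rewrite w0//; exact: OmCo.
Qed.

Let L2_on_nice f : L2_on f -> nice (onOm f).
Proof.
move=> [mf f2]; split; [exact: monOm|by rewrite sqnorm_onOm|].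
by move=> x; exact: onOm_out.
Qed.

Let test_nice v : test_space v -> nice (onOm v).
Proof. by move=> [[_ v2 _] _]; exact: L2_on_nice. Qed.

Let test_ae v : test_space v -> {ae mu, forall x, onE v x = onOm v x}.
Proof.
move=> [_ v0]; apply: filterS v0 => x /= vx.
have [Ox|nOx] := pselect (Om x); first by rewrite onOm_in// onE_in//; left.
rewrite onOm_out//; have [Ex|nEx] := pselect (E x); last by rewrite onE_out.
by rewrite onE_in//; case: Ex => // /vx.
Qed.

Let space_onE u : energy_space u ->
  measurable_fun setT (onE u) /\ (seminorm2 (onE u) < +oo)%E.
Proof.
move=> [mu_ _ uoo]; split; first exact: monE.
by rewrite -iterated_seminorm2E.
Qed.

Let Rintegral_onOm f v :
  \int[mu]_(x in Om) (f x * v x) = \int[mu]_x (onOm v x * onOm f x).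
Proof.
rewrite Rintegral_mkcond; apply: eq_Rintegral => x _; rewrite patchE.
have [Ox|nOx] := pselect (Om x); first by rewrite mem_set// !onOm_in// mulrC.
by rewrite memNset// !onOm_out// mul0r.
Qed.

(** The load that remains for the correction after the datum g has been moved to the
right-hand side. *)
Let load f g := onOm (fun x => f x - nonlocal (onE g) x).

Let loadE f g x : load f g x = onOm f x - nonlocal (onE g) x * \1_Om x.
Proof. by rewrite /load /onOm mulrBl. Qed.

Let measurable_load f g : L2_on f -> energy_space g ->
  measurable_fun setT (load f g).
Proof.
move=> [mf _] /space_onE[mg _].
rewrite (_ : load f g = fun x => onOm f x - nonlocal (onE g) x * \1_Om x); last first.
  by apply/funext => x; exact: loadE.
have mof := monOm mf; have mn := measurable_nonlocal mg; by mfun.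
Qed.

Let sqnorm_load f g : L2_on f -> energy_space g ->
  (sqnorm mu (load f g) <=
   2%:E * sqnorm mu (onOm f) + 2%:E * (M%:E * seminorm2 (onE g)))%E.
Proof.
move=> [mf _] /space_onE[mg _].
rewrite (_ : load f g = fun x => onOm f x + - (nonlocal (onE g) x * \1_Om x)); last first.
  by apply/funext => x; exact: loadE.
have mof := monOm mf; have mn := measurable_nonlocal mg.
have mnn : measurable_fun setT (fun x => nonlocal (onE g) x * \1_Om x) by mfun.
have mNn : measurable_fun setT (fun x => - (nonlocal (onE g) x * \1_Om x)).
  exact: measurableT_comp.
apply: le_trans (sqnormD _ mof mNn) _; apply: leeD => //.
apply: lee_wpmul2l; first by rewrite lee_fin.
apply: le_trans (sqnorm_nonlocal mg); apply: sqnorm_le => // x.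
by rewrite normrN.
Qed.

Let load_nice f g : L2_on f -> energy_space g -> nice (load f g).
Proof.
move=> hf hg; split; [exact: measurable_load| |by move=> x; exact: onOm_out].
apply: le_lt_trans (sqnorm_load hf hg) _.
have [mg goo] := space_onE hg; have [_ f2 _] := L2_on_nice hf.
apply: lty_comb => //; [exact: sqnorm_ge0| |].
- by rewrite mule_ge0 ?seminorm2_ge0// lee_fin ltW.
- by rewrite lte_mul_pinfty ?seminorm2_ge0// lee_fin ltW.
Qed.

Let pairing_load f g v : L2_on f -> energy_space g -> nice v ->
  \int[mu]_x (v x * load f g x) =
  \int[mu]_x (v x * onOm f x) - \int[mu]_x (v x * nonlocal (onE g) x).
Proof.
move=> hf hg [mv v2 v0]; have [mg goo] := space_onE hg.
have [mf f2 _] := L2_on_nice hf.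
rewrite -RintegralB//; [|exact: integrable_mul|exact: integrable_mul_nonlocal].
apply: eq_Rintegral => x _; have [Ox|nOx] := pselect (Om x).
  by rewrite /load !onOm_in// mulrBr.
by rewrite v0// !mul0r subrr.
Qed.

Let pairing_nonlocalD u w v : measurable_fun setT u -> (seminorm2 u < +oo)%E ->
  nice w -> nice v ->
  \int[mu]_x (v x * nonlocal (fun y => u y + w y) x) =
  \int[mu]_x (v x * nonlocal u x) + \int[mu]_x (v x * nonlocal w x).
Proof.
move=> mu_ uoo nw [mv v2 v0]; have [mw w2 w0] := nw.
have woo := nice_seminorm2 nw.
have muw : measurable_fun setT (fun y => u y + w y) by mfun.
rewrite -RintegralD//; [|exact: integrable_mul_nonlocal..].
rewrite /Rintegral; congr fine.
have mnu := measurable_nonlocal mu_; have mnw := measurable_nonlocal mw.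
have mnuw := measurable_nonlocal muw.
apply: ae_eq_integral => //; [by apply/measurable_EFinP; mfun..|].
apply: filterS2 (ae_slice_lty mu_ uoo) (ae_slice_lty mw woo) => x ux wx _.
congr EFin; have [Ox|nOx] := pselect (Om x); last by rewrite v0// !mul0r addr0.
by rewrite nonlocalD ?mulrDr//; [exact: ux|exact: wx].
Qed.

Let pairing_nonlocalB u w v : nice u -> nice w -> nice v ->
  \int[mu]_x (v x * nonlocal (fun y => u y - w y) x) =
  \int[mu]_x (v x * nonlocal u x) - \int[mu]_x (v x * nonlocal w x).
Proof.
move=> nu nw [mv v2 v0]; have [mu_ u2 u0] := nu; have [mw w2 w0] := nw.
rewrite -RintegralB//;
  [|by apply: integrable_mul_nonlocal => //; exact: nice_seminorm2..].
apply: eq_Rintegral => x _; rewrite -mulrBr; congr (_ * _).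
rewrite !nonlocal_average//; [|by mfun|exact: sqnormB_lty].
have iu := average_integrable x mu_ u2; have iw := average_integrable x mw w2.
have -> : average (fun y => u y - w y) x = average u x - average w x.
  by rewrite /average -RintegralB//; apply: eq_Rintegral => y _; rewrite mulrBl.
by ring.
Qed.

Let energy_split g w v u : energy_space g -> nice w -> test_space v ->
  measurable_fun E u -> {ae mu, forall x, onE u x = onE g x + w x} ->
  energy_form u v = \int[mu]_x (onOm v x * nonlocal (onE g) x) +
                    \int[mu]_x (onOm v x * nonlocal w x).
Proof.
move=> hg nw hv mu_ uE; have [mg goo] := space_onE hg; have [mw w2 w0] := nw.
have nv := test_nice hv; have [mv v2 v0] := nv.
have mgw : measurable_fun setT (fun x => onE g x + w x) by mfun.
have gwoo : (seminorm2 (fun x => onE g x + w x)%R < +oo)%E.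
  apply: le_lt_trans (seminorm2D mg mw) _.
  by apply: lty_comb; rewrite ?seminorm2_ge0//; exact: nice_seminorm2.
have mvE : measurable_fun setT (onE v) by apply: monE; case: hv => -[].
rewrite energy_onE (energy_form_ae (monE mu_) mgw mvE mv uE (test_ae hv)).
by rewrite green// pairing_nonlocalD.
Qed.

Let correction_nice g u : test_space (fun x => u x - g x) ->
  nice (onOm (fun x => u x - g x)).
Proof. exact: test_nice. Qed.

Let solution_ae g u : test_space (fun x => u x - g x) ->
  {ae mu, forall x, onE u x = onE g x + onOm (fun x => u x - g x) x}.
Proof.
move=> h; apply: filterS (test_ae h) => x <-.
have [Ex|nEx] := pselect (E x); first by rewrite !onE_in// addrC subrK.
by rewrite !onE_out// addr0.
Qed.

(** The weak equation for u says that w, the restriction of u - g to Omega, solves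
Lw = f - Lg weakly. *)
Lemma weak_solution_correction f g u v : L2_on f -> energy_space g ->
  weak_solution f g u -> nice v ->
  \int[mu]_x (v x * nonlocal (onOm (fun x => u x - g x)) x) =
  \int[mu]_x (v x * load f g x).
Proof.
move=> hf hg [[mu_ _ _] hw hu] nv; rewrite pairing_load//.
have := hu v (nice_test nv).
rewrite (energy_split hg (correction_nice hw) (nice_test nv) mu_ (solution_ae hw)).
by rewrite Rintegral_onOm onOm_nice// => <-; rewrite addrC addKr.
Qed.

Lemma weak_solution_exists f g : L2_on f -> energy_space g ->
  exists u, weak_solution f g u.
Proof.
move=> hf hg; have nF := load_nice hf hg; have [mF F2 _] := nF.
have [w [mw w2 w0 Lw]] := solve mF F2; have nw : nice w by [].
have [mg goo] := space_onE hg; have [mgE [mgO g2] _] := hg.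
exists (fun x => g x + w x).
have muE : measurable_fun E (fun x => g x + w x).
  by apply: measurable_funD => //; exact: measurable_funTS.
have uE : onE (fun x => g x + w x) = (fun x => onE g x + w x).
  apply/funext => x; have [Ex|nEx] := pselect (E x); first by rewrite !onE_in.
  by rewrite !onE_out// w0 ?addr0// => Ox; apply: nEx; left.
have hw : (fun x => g x + w x - g x) = w.
  by apply/funext => x; rewrite addrC addKr.
split.
- split=> //.
  + split; first by apply: measurable_funD => //; exact: measurable_funTS.
    rewrite -sqnorm_onOm (_ : onOm _ = fun x => onOm g x + w x); last first.
      apply/funext => x; have [Ox|nOx] := pselect (Om x); first by rewrite !onOm_in.
      by rewrite !onOm_out// w0// addr0.
    by apply: sqnormD_lty => //; [exact: monOm|rewrite sqnorm_onOm].
  + rewrite iterated_seminorm2E// uE; apply: le_lt_trans (seminorm2D mg mw) _.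
    by apply: lty_comb; rewrite ?seminorm2_ge0//; exact: nice_seminorm2.
- by rewrite hw; exact: nice_test.
move=> v hv; have nv := test_nice hv; have [mv v2 v0] := nv.
rewrite (energy_split hg nw hv muE); last by apply: aeW => x; rewrite uE.
rewrite Rintegral_onOm.
have -> : \int[mu]_x (onOm v x * nonlocal w x) = \int[mu]_x (onOm v x * load f g x).
  apply: eq_Rintegral => x _; have [Ox|nOx] := pselect (Om x); first by rewrite Lw.
  by rewrite onOm_out// !mul0r.
by rewrite pairing_load// addrC subrK.
Qed.

(** The difference of two corrections pairs with its own image under L to 0; the a priori
estimate with F = 0 makes it vanish. *)
Lemma weak_solution_unique f g u1 u2 : L2_on f -> energy_space g ->
  weak_solution f g u1 -> weak_solution f g u2 -> u1 = u2 %[ae mu in E].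
Proof.
move=> hf hg h1 h2.
pose w1 := onOm (fun x => u1 x - g x); pose w2 := onOm (fun x => u2 x - g x).
have [_ t1 _] := h1; have [_ t2 _] := h2.
have n1 : nice w1 by exact: correction_nice.
have n2 : nice w2 by exact: correction_nice.
have [m1 s1 z1] := n1; have [m2 s2 z2] := n2.
have nd : nice (fun x => w1 x - w2 x).
  split; [by mfun|exact: sqnormB_lty|].
  by move=> x nOx; rewrite z1// z2// subrr.
have [md sd zd] := nd.
have [C C0 HC] := apriori.
have zero2 : sqnorm mu (cst 0 : T -> R) = 0%E.
  by rewrite /sqnorm integral0_eq// => x _; rewrite expr0n.
have d0 : sqnorm mu (fun x => w1 x - w2 x) = 0%E.
  apply/eqP; rewrite eq_le sqnorm_ge0 andbT.
  have F2 : (sqnorm mu (cst 0%R : T -> R) < +oo)%E by rewrite zero2.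
  have := (HC _ (cst 0) md (measurable_cst _) zd sd F2 _).1.
  rewrite zero2 mule0; apply.
  rewrite pairing_nonlocalB// (weak_solution_correction hf hg h1 nd).
  rewrite (weak_solution_correction hf hg h2 nd) subrr.
  by rewrite /Rintegral integral0_eq// => x _; rewrite mulr0.
have d_ae : {ae mu, forall x, w1 x = w2 x}.
  have msq : measurable_fun setT (fun x => ((w1 x - w2 x) ^+ 2)%:E).
    by apply/measurable_EFinP; mfun.
  have : (\int[mu]_x `|((w1 x - w2 x) ^+ 2)%:E| = 0)%E.
    by rewrite -[RHS]d0; apply: eq_integral => x _; rewrite gee0_abs// lee_fin sqr_ge0.
  move=> /(ae_eq_integral_abs mu measurableT msq); apply: filterS => x /(_ I) /= [].
  by move=> /eqP; rewrite sqrf_eq0 subr_eq0 => /eqP.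
apply: filterS3 d_ae (solution_ae t1) (solution_ae t2) => x dx e1 e2 Ex.
by rewrite -(onE_in u1 Ex) -(onE_in u2 Ex) e1 e2 -/w1 -/w2 dx.
Qed.

Lemma weak_solution_bound : exists2 C : R, 0 < C &
  forall f g u, L2_on f -> energy_space g -> weak_solution f g u ->
    (\int[mu]_(x in Om) (u x ^+ 2)%:E + iterated_seminorm2 u <=
     C%:E * (\int[mu]_(x in Om) (f x ^+ 2)%:E +
             (\int[mu]_(x in Om) (g x ^+ 2)%:E + iterated_seminorm2 g)))%E.
Proof.
have [C C0 HC] := apriori.
exists (2 + 8 * C * (1 + M)).
  by rewrite addr_gt0// mulr_gt0 ?addr_gt0// mulr_gt0.
move=> f g u hf hg hu; have [[muE [muO _] _] tu _] := hu.
have [mgE [mgO _] _] := hg; have [mg goo] := space_onE hg.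
pose w := onOm (fun x => u x - g x).
have nw : nice w by exact: correction_nice.
have [mw w2 w0] := nw; have [mF F2 _] := load_nice hf hg.
have [] := HC w (load f g) mw mF w0 w2 F2.
  by rewrite (weak_solution_correction hf hg hu nw).
have [mof f2 _] := L2_on_nice hf.
have := sqnorm_load hf hg.
rewrite !iterated_seminorm2E// -!sqnorm_onOm.
have uO : (sqnorm mu (onOm u) <= 2%:E * sqnorm mu (onOm g) + 2%:E * sqnorm mu w)%E.
  rewrite (_ : onOm u = fun x => onOm g x + w x); first by apply: sqnormD => //; exact: monOm.
  apply/funext => x; rewrite /w; have [Ox|nOx] := pselect (Om x).
    by rewrite !onOm_in// addrC subrK.
  by rewrite !onOm_out// addr0.
have uS : (seminorm2 (onE u) <= 2%:E * seminorm2 (onE g) + 2%:E * seminorm2 w)%E.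
  rewrite (seminorm2_ae (monE muE) _ (solution_ae tu)); last by mfun.
  exact: seminorm2D.
move: uO uS.
have fin_sq h : (sqnorm mu h < +oo)%E -> sqnorm mu h \is a fin_num.
  by move=> ?; rewrite ge0_fin_numE// sqnorm_ge0.
have fin_sem h : (seminorm2 h < +oo)%E -> seminorm2 h \is a fin_num.
  by move=> ?; rewrite ge0_fin_numE// seminorm2_ge0.
have [_ g2 _] := L2_on_nice (let: And3 _ h _ := hg in h).
have [_ u2 _] := L2_on_nice (let: And3 _ h _ := (let: And3 h _ _ := hu in h) in h).
have [_ uoo] := space_onE (let: And3 h _ _ := hu in h).
have := fine_ge0 (sqnorm_ge0 mu (onOm f)); have := fine_ge0 (sqnorm_ge0 mu (onOm g)).
have := fine_ge0 (seminorm2_ge0 (onE g)).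
rewrite -(fineK (fin_sq _ w2)) -(fineK (fin_sq _ F2)) -(fineK (fin_sq _ f2)).
rewrite -(fineK (fin_sq _ g2)) -(fineK (fin_sq _ u2)) -(fineK (fin_sem _ uoo)).
rewrite -(fineK (fin_sem _ goo)) -(fineK (fin_sem _ (nice_seminorm2 nw))).
rewrite -?EFinM -?EFinD -?EFinM -?EFinD !lee_fin /=.
set sg := fine (seminorm2 (onE g)); set su := fine (seminorm2 (onE u)).
set sw := fine (seminorm2 w); set qw := fine (sqnorm mu w).
set qu := fine (sqnorm mu (onOm u)); set qg := fine (sqnorm mu (onOm g)).
set qf := fine (sqnorm mu (onOm f)); set qF := fine (sqnorm mu (load f g)).
move=> sg0 qg0 qf0 hu_ hs hF hq hsw.
have hF' : C * qF <= C * (2 * qf + 2 * (M * sg)) by rewrite ler_pM2l.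
have a1 : 0 <= C * qg by rewrite mulr_ge0// ltW.
have a2 : 0 <= C * M * qg by rewrite !mulr_ge0// ltW.
have a3 : 0 <= C * M * qf by rewrite !mulr_ge0// ltW.
have a4 : 0 <= C * sg by rewrite mulr_ge0// ltW.
have h1 : qu + su <= 2 * qg + 2 * sg + 4 * (C * (2 * qf + 2 * (M * sg))) by lra.
apply: le_trans h1 _; rewrite -subr_ge0.
rewrite (_ : _ - _ = 2 * qf + 8 * (C * qg) + 8 * (C * M * qg) + 8 * (C * M * qf) +
  8 * (C * sg)); last by ring.
by rewrite !addr_ge0// mulr_ge0.
Qed.

End weak_problem.
End solve.
End walk.
End symmetric_kernel.

(** * Geometry of R^n *)

Section rV_geometry.
Context {R : realType} {n : nat}.
Implicit Types (x y p : 'rV[R]_n) (A U : set 'rV[R]_n).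

Definition shifted_box x (s t : R) : set 'rV[R]_n :=
  [set y | forall i, x ord0 i + s < y ord0 i < x ord0 i + t].

Lemma measurable_shifted_box x s t : measurable (shifted_box x s t).
Proof.
rewrite (_ : shifted_box x s t = \bigcap_(i in [set: 'I_n])
  ((fun y : 'rV[R]_n => y ord0 i) @^-1` `]x ord0 i + s, x ord0 i + t[)).
  apply: fin_bigcap_measurable; first exact: finite_finset.
  move=> i _; rewrite -[X in measurable X]setTI.
  exact: (measurable_coord i).
apply/seteqP; split=> y /= H i; first by move=> _; rewrite /= in_itv/= H.
by have := H i I; rewrite /= in_itv.
Qed.

(** An open set is a union of boxes with rational centres and radii 1 / (m + 1). *)
Lemma open_measurable_rV U : open U -> measurable U.
Proof.
move=> oU.
pose r (m : nat) : R := m.+1%:R^-1.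
pose box (qm : 'rV[rat]_n * nat) := shifted_box (map_mx ratr qm.1) (- r qm.2) (r qm.2).
pose F qm := [set y | box qm `<=` U /\ box qm y].
rewrite (_ : U = \bigcup_qm F qm).
  apply: countable_bigcupT_measurable => [|qm]; first exact: countableP.
  have [h|h] := pselect (box qm `<=` U).
    rewrite (_ : F qm = box qm); first exact: measurable_shifted_box.
    by apply/seteqP; split=> y => [[]|].
  by rewrite (_ : F qm = set0)//; apply/seteqP; split=> y => [[]|].
apply/seteqP; split=> [x Ux|x [qm _] [+]]; last exact.
have /nbhs_ballP[e /= e0 xeU] : nbhs x U by exact: open_nbhs_nbhs.
have [m /= rm] : exists m, r m < e / 2.
  have e2 : 0 < e / 2 by rewrite divr_gt0.
  exists (Num.truncn (e / 2)^-1); rewrite /r invf_plt ?posrE// ?ltr0n//.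
  by rewrite truncnS_gt.
have r0 : 0 < r m by rewrite invr_gt0 ltr0n.
have /choice[q Hq] (i : 'I_n) : exists q : rat, x ord0 i - r m < ratr q < x ord0 i + r m.
  have /rat_in_itvoo[q] : x ord0 i - r m < x ord0 i + r m by lra.
  by rewrite in_itv/=; exists q.
exists (\row_i q i, m) => //; split; last first.
  by move=> i; rewrite !mxE; have := Hq i; lra.
move=> y yq; apply: xeU; split=> // i j; rewrite ord1 /ball /= ltr_norml.
have := yq j; rewrite !mxE; have := Hq j; move: rm; lra.
Qed.

Lemma coord_sqr_le (v : 'rV[R]_n) i : v ord0 i ^+ 2 <= \sum_j v ord0 j ^+ 2.
Proof.
rewrite (bigD1 i)//= lerDl; apply: sumr_ge0 => j _; exact: sqr_ge0.
Qed.

Lemma coord_le_norm x i : `|x ord0 i| <= `|x|.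
Proof.
rewrite [leRHS]mx_normrE.
exact: (le_bigmax _ (fun ij : 'I_1 * 'I_n => `|x ij.1 ij.2|) (ord0, i)).
Qed.

Lemma sum_sqr_ge0 (v : 'rV[R]_n) : 0 <= \sum_j v ord0 j ^+ 2.
Proof. by apply: sumr_ge0 => j _; exact: sqr_ge0. Qed.

Lemma enorm_lt (v : 'rV[R]_n) e : 0 < e ->
  (enorm v < e) = (\sum_j v ord0 j ^+ 2 < e ^+ 2).
Proof.
move=> e0; rewrite -[in LHS](gtr0_norm e0) -sqrtr_sqr.
by rewrite /enorm ltr_sqrt// exprn_gt0.
Qed.

Lemma enormN (v : 'rV[R]_n) : enorm (- v) = enorm v.
Proof. by rewrite /enorm; under eq_bigr do rewrite mxE sqrrN. Qed.

Lemma enorm_ball_box x y e : 0 < e -> enorm (x - y) < e -> shifted_box x (- e) e y.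
Proof.
move=> e0; rewrite enorm_lt// => h i.
have := le_lt_trans (coord_sqr_le (x - y) i) h; rewrite !mxE => h2.
by apply/andP; split; nra.
Qed.

Lemma measurable_coordB (i : 'I_n) :
  measurable_fun setT (fun z : 'rV[R]_n * 'rV[R]_n => (z.1 - z.2) ord0 i).
Proof.
under eq_fun do rewrite !mxE.
by apply: measurable_funB; apply: (measurableT_comp (measurable_coord i)); mfun.
Qed.

Lemma enorm_ball_open p e : 0 < e -> open [set x | enorm (x - p) < e].
Proof.
move=> e0; pose q x : R := \sum_j (x ord0 j - p ord0 j) ^+ 2.
have cq : continuous q.
  apply: continuous_big => [|j _ x].
    exact: (@pseudometric_normed_Zmodule.add_continuous _ R).
  have c : (fun y : 'rV[R]_n => y ord0 j - p ord0 j) y @[y --> x] --> x ord0 j - p ord0 j.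
    exact: (cvgB (@coord_continuous R 1 n ord0 j x) (cvg_cst _)).
  exact: (cvgM c c).
rewrite (_ : [set x | _] = q @^-1` [set t | t < e ^+ 2]).
  by apply: open_comp => [x _|]; [exact: cq|exact: open_lt].
apply/seteqP; split=> x /=; rewrite enorm_lt// /q.
  by under eq_bigr do rewrite !mxE.
by under [in X in _ -> X]eq_bigr do rewrite !mxE.
Qed.

Lemma measurable_collar (Omega : set 'rV[R]_n) delta : 0 < delta -> open Omega ->
  measurable (collar Omega delta).
Proof.
move=> d0 oO; rewrite (_ : collar Omega delta = ~` Omega `&`
  \bigcup_(p in boundary Omega) [set x | enorm (x - p) < delta]).
  apply: measurableI; first by apply: measurableC; exact: open_measurable_rV.
  by apply: open_measurable_rV; apply: bigcup_open => p _; exact: enorm_ball_open.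
apply/seteqP; split=> x [nOx]; rewrite /edist.
  by move=> /ereal_inf_lt[_ [p bp <-]]; rewrite lte_fin => xp; split=> //; exists p.
move=> [p bp /= xp]; split=> //=.
apply: (@le_lt_trans _ _ (enorm (x - p))%:E); rewrite ?lte_fin//.
by apply: ereal_inf_lbound; exists p.
Qed.

(** If s is the supremum of the times t in [0, 1] at which x + t (y - x) lies in A, the
point reached at time s is a limit of points of A from the left and of points of the
complement from the right (when s = 1, it is y itself). *)
Lemma segment_meets_boundary A x y : A x -> ~ A y ->
  exists2 p, boundary A p & enorm (y - p) <= enorm (x - y).
Proof.
move=> Ax nAy; pose g (t : R) := x + t *: (y - x).
pose J : set R := [set t | 0 <= t <= 1 /\ A (g t)].
have J0 : J 0 by split; rewrite ?lexx ?ler01// /g scale0r addr0.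
have Jub : ubound J 1 by move=> t [/andP[]].
have hJ : has_sup J by split; [exists 0|exists 1].
pose s := sup J.
have Jle t : J t -> t <= s by apply: ub_le_sup; exists 1.
have s0 : 0 <= s by exact: Jle.
have s1 : s <= 1 by apply: ge_sup => //; exists 0.
have near_g t e : 0 < e -> `|t - s| * `|y - x| < e -> ball (g s) e (g t).
  move=> e0 h; rewrite -ball_normE /= /g opprD addrACA subrr add0r -scalerBl.
  by rewrite normrZ distrC.
have approx e : 0 < e -> exists2 c, 0 < c & forall t, `|t - s| < c -> ball (g s) e (g t).
  move=> e0; have yx0 : 0 < `|y - x| + 1 by rewrite ltr_wpDl.
  exists (e / (`|y - x| + 1)); first by rewrite divr_gt0.
  move=> t; rewrite ltr_pdivlMr// => h; apply: near_g => //.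
  by apply: le_lt_trans h; rewrite ler_wpM2l// lerDl.
exists (g s); first split.
- move=> B /nbhs_ballP[e /= e0 eB]; have [c c0 Hc] := approx e e0.
  have [t Jt st] := sup_adherent c0 hJ.
  exists (g t); split; first by case: Jt.
  apply: eB; apply: Hc; have ts : t <= s by exact: Jle.
  by rewrite ltr_norml; move: st ts c0; rewrite -/s; lra.
- move=> B /nbhs_ballP[e /= e0 eB]; have [c c0 Hc] := approx e e0.
  have [s1'|] := ltP s 1; last first.
    move=> s1'; have sE : s = 1 by apply/eqP; rewrite eq_le s1.
    exists y; split=> //; apply: eB.
    have := Hc 1; rewrite (_ : g 1 = y); last by rewrite /g scale1r addrC subrK.
    by apply; rewrite sE subrr normr0.
  pose t := Num.min (s + c / 2) 1.
  have st : s < t by rewrite lt_min s1' andbT; move: c0; lra.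
  have t1 : t <= 1 by rewrite ge_min lexx orbT.
  have tc : t <= s + c / 2 by rewrite ge_min lexx.
  exists (g t); split.
    move=> Agt; have : t <= s by apply: Jle; split=> //; rewrite t1 (le_trans s0)// ltW.
    by rewrite leNgt st.
  by apply: eB; apply: Hc; rewrite ltr_norml; move: st tc c0; lra.
rewrite /enorm ler_sqrt ?sum_sqr_ge0//; apply: ler_sum => i _.
rewrite /g !mxE (_ : y ord0 i - _ = (1 - s) * (y ord0 i - x ord0 i)); last by ring.
rewrite exprMn -[leRHS]mul1r -(sqrrN (x ord0 i - _)) opprB ler_wpM2r ?sqr_ge0//.
by rewrite expr_le1// ?subr_ge0// gerBl.
Qed.

End rV_geometry.

(** * The indicator of a ball as a kernel *)

Section lebesgue_rV_box.
Context {R : realType}.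

Lemma lebesgue_rV_shifted_box d (x : 'rV[R]_d) (s t : R) : s < t ->
  lebesgue_rV d (shifted_box x s t) = ((t - s) ^+ d)%:E.
Proof.
move=> st; elim: d x => [|d ih] x.
  rewrite expr0 (_ : shifted_box x s t = setT) /=; last first.
    by apply/seteqP; split=> // y _ [].
  by rewrite diracE mem_set.
change (lebesgue_step (lebesgue_rV d) (shifted_box x s t) = ((t - s) ^+ d.+1)%:E).
rewrite /lebesgue_step /pushforward.
pose x' := (uncons_rV x).2.
rewrite (_ : _ @^-1` _ =
    [set` `]x ord0 ord0 + s, x ord0 ord0 + t[] `*` shifted_box x' s t); last first.
  have x'E j : x' ord0 j = x ord0 (lift ord0 j).
    by rewrite /x' /uncons_rV /= mxE; congr (x ord0 _); exact: val_inj.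
  apply/seteqP; split=> -[a y] /=.
    move=> h; split; first by have := h ord0; rewrite cons_rVE unlift_none/= in_itv.
    by move=> j; have := h (lift ord0 j); rewrite cons_rVE liftK/= x'E.
  move=> [ha hy] i; rewrite cons_rVE; case: unliftP => [j|] ->.
    by have := hy j; rewrite x'E.
  by move: ha; rewrite in_itv.
rewrite product_measure1E//; last exact: measurable_shifted_box.
rewrite [X in (_ * X)%E]ih.
have := lebesgue_measure_itv `]x ord0 ord0 + s, x ord0 ord0 + t[.
rewrite /= lte_fin ltrD2l st => lenE.
rewrite [X in (X * _)%E]lenE -EFinB -EFinM exprS.
by congr (_ * _)%:E; ring.
Qed.

End lebesgue_rV_box.

Section ball_kernel.
Context {R : realType} {d : nat}.
Variables (Omega : set 'rV[R]_d) (delta : R).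
Hypothesis (d_gt0 : (0 < d)%N) (bOmega : bounded_set Omega)
  (delta_gt0 : 0 < delta).
Local Notation mu := (@lebesgue_rV R d).

Definition ball_kernel (z : 'rV[R]_d * 'rV[R]_d) : R := nu delta (z.1 - z.2).

Lemma ball_kernelE x y : enorm (x - y) < delta -> ball_kernel (x, y) = 1.
Proof. by move=> h; rewrite /ball_kernel /nu indicE mem_set. Qed.

Lemma ball_kernel_out x y : ~ enorm (x - y) < delta -> ball_kernel (x, y) = 0.
Proof. by move=> h; rewrite /ball_kernel /nu indicE memNset. Qed.

Lemma ball_kernel_ge0 z : 0 <= ball_kernel z.
Proof. by rewrite /ball_kernel /nu indicE. Qed.

Lemma ball_kernel_le1 z : ball_kernel z <= 1.
Proof. by rewrite /ball_kernel /nu indicE; case: (_ \in _). Qed.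

Lemma ball_kernelC x y : ball_kernel (x, y) = ball_kernel (y, x).
Proof.
have [h|h] := pselect (enorm (x - y) < delta).
  by rewrite !ball_kernelE// -enormN opprB.
by rewrite !ball_kernel_out// -enormN opprB.
Qed.

Lemma measurable_ball_kernel : measurable_fun setT ball_kernel.
Proof.
pose q (z : 'rV[R]_d * 'rV[R]_d) : R := \sum_(j < d) (z.1 - z.2) ord0 j ^+ 2.
have mq : measurable_fun setT q.
  apply: measurable_sum => j; apply: measurable_funX.
  exact: measurable_coordB.
have mA : measurable [set z | q z < delta ^+ 2].
  rewrite -[X in measurable X]setTI.
  rewrite (_ : [set z | _] = q @^-1` `]-oo, delta ^+ 2[); first exact: mq.
  by apply/seteqP; split=> z /=; rewrite in_itv.
rewrite (_ : ball_kernel = \1_[set z | q z < delta ^+ 2]).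
  exact: measurable_indic.
apply/funext => -[x y]; rewrite indicE.
have [h|h] := pselect (enorm (x - y) < delta).
  by rewrite ball_kernelE// mem_set//= -enorm_lt.
by rewrite ball_kernel_out// memNset//= /q/= -enorm_lt.
Qed.

Lemma ball_kernel_row_le x :
  (\int[mu]_y (ball_kernel (x, y))%:E <= ((2 * delta) ^+ d)%:E)%E.
Proof.
have mbox := measurable_shifted_box x (- delta) delta.
apply: (@le_trans _ _ (\int[mu]_y (\1_(shifted_box x (- delta) delta) y)%:E)%E).
  apply: ge0_le_integral_EFin.
  - exact: measurable_section measurable_ball_kernel.
  - exact: measurable_indic.
  - by move=> y; exact: ball_kernel_ge0.
  move=> y; have [h|h] := pselect (enorm (x - y) < delta).
    by rewrite ball_kernelE// indicE mem_set//; exact: enorm_ball_box.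
  by rewrite ball_kernel_out// indicE.
rewrite integral_indic// setIT [leLHS]lebesgue_rV_shifted_box; last first.
  by apply: lt_trans delta_gt0; rewrite oppr_lt0.
by rewrite (_ : delta - - delta = 2 * delta)//; ring.
Qed.

(** The segment from x to y crosses the boundary of Omega at a distance less than delta
from y. *)
Lemma ball_kernel_support x y : Omega x -> ~ domE Omega delta y ->
  ball_kernel (x, y) = 0.
Proof.
move=> Ox nEy; apply: ball_kernel_out => xy; apply: nEy.
have [Oy|nOy] := pselect (Omega y); [by left|right; split=> //].
have [p bp py] := segment_meets_boundary Ox nOy.
apply: (@le_lt_trans _ _ (enorm (y - p))%:E); last first.
  by rewrite lte_fin; exact: le_lt_trans py xy.
by apply: ereal_inf_lbound; exists p.
Qed.

(** Small enough that the points whose coordinates are all between x_i - 2 step and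
x_i - step are in the ball of radius delta around x: 4 d < (2 d + 1)^2. *)
Let step : R := delta / (2 * d%:R + 1).

Let step_gt0 : 0 < step.
Proof. by rewrite divr_gt0// addr_gt0// mulr_gt0// ltr0n. Qed.

Lemma shifted_box_ball (x y : 'rV[R]_d) : shifted_box x (- (2 * step)) (- step) y ->
  enorm (x - y) < delta.
Proof.
move=> h; rewrite enorm_lt//.
have d1 : 1 <= d%:R :> R by rewrite ler1n.
apply: (@le_lt_trans _ _ (\sum_(j < d) (2 * step) ^+ 2)).
  apply: ler_sum => j _; rewrite !mxE; have := h j; have := step_gt0.
  by move=> ? /andP[? ?]; rewrite ler_sqr ?nnegrE; lra.
rewrite sumr_const card_ord -mulr_natr.
have -> : delta = (2 * d%:R + 1) * step.
  by rewrite /step mulrC divfK// gt_eqF// addr_gt0// mulr_gt0// ltr0n.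
rewrite [ltRHS]exprMn [ltLHS](_ : _ = 4 * d%:R * step ^+ 2); last by ring.
rewrite ltr_pM2r ?exprn_gt0//.
by move: d1; set r : R := d%:R; nra.
Qed.

(** S n is the half-space of the points whose first coordinate is less than -B + n step,
with B a bound for Omega.  The box below x, of volume step ^ d, is one half-space
earlier. *)
Lemma ball_kernel_walk : exists (S : nat -> set 'rV[R]_d) (N : nat),
  [/\ forall n, measurable (S n), forall x, Omega x -> ~ S 0%N x, Omega `<=` S N &
      forall n x, S n.+1 x ->
        ((step ^+ d)%:E <= \int[mu]_(y in S n) (ball_kernel (x, y))%:E)%E].
Proof.
pose i0 : 'I_d := Ordinal d_gt0.
have [B HB] : exists B : R, forall x, Omega x -> `|x| <= B.
  case: bOmega => M0 [M0r HM]; exists (M0 + 1) => x Ox.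
  by apply: (HM (M0 + 1)) => //; rewrite ltrDl.
pose S n : set 'rV[R]_d := [set x | x ord0 i0 < - B + n%:R * step].
have mS n : measurable (S n).
  rewrite (_ : S n = (fun x : 'rV[R]_d => x ord0 i0) @^-1` `]-oo, (- B + n%:R * step)[).
    rewrite -[X in measurable X]setTI; exact: (measurable_coord i0).
  by apply/seteqP; split=> x /=; rewrite in_itv.
have OB x : Omega x -> - B <= x ord0 i0 <= B.
  by move=> /HB; rewrite -ler_norml; apply: le_trans; exact: coord_le_norm.
exists S, (Num.truncn (2 * B / step)).+1; split=> //.
- by move=> x /OB; rewrite /S /= mul0r addr0; lra.
- move=> x /OB /andP[_ xB]; rewrite /S /=.
  have := truncnS_gt (2 * B / step); rewrite ltr_pdivrMr//; lra.
move=> n x Sx; pose b := shifted_box x (- (2 * step)) (- step).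
have mb : measurable b by exact: measurable_shifted_box.
have bS : b `<=` S n.
  move=> y /(_ i0); move: Sx; rewrite /S /= -natr1; lra.
have mk := measurable_section x measurable_ball_kernel.
apply: (@le_trans _ _ (\int[mu]_(y in b) (ball_kernel (x, y))%:E)%E); last first.
  apply: ge0_subset_integral => //.
  - by apply: measurable_funTS; exact/measurable_EFinP.
  - by move=> y _; rewrite lee_fin ball_kernel_ge0.
have -> : (\int[mu]_(y in b) (ball_kernel (x, y))%:E = \int[mu]_(y in b) (cst 1 y))%E.
  by apply: eq_integral => y; rewrite inE => /shifted_box_ball/ball_kernelE ->.
rewrite integral_cst// mul1e /b [leRHS]lebesgue_rV_shifted_box; last by have := step_gt0; lra.
by rewrite (_ : - step - - (2 * step) = step)//; ring.
Qed.

End ball_kernel.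


Theorem corollary1p2 (R : realType) (d : nat) (hd : (0 < d)%N)
    (Omega : set 'rV[R]_d) (hbounded : bounded_set Omega)
    (hconnected : connected Omega) (hopen : open Omega)
    (hlip : lipschitz_boundary Omega) (delta : R) (hdelta : 0 < delta) :
  (forall f g : 'rV[R]_d -> R, L2 Omega f -> V_nu Omega delta g ->
     (exists u, variational_solution Omega delta f g u) /\
     (forall u w, variational_solution Omega delta f g u ->
        variational_solution Omega delta f g w ->
        u = w %[ae lebesgue_rV d in domE Omega delta])) /\
  (exists2 C : R, 0 < C &
     forall f g u : 'rV[R]_d -> R, L2 Omega f -> V_nu Omega delta g ->
       variational_solution Omega delta f g u ->
       V_norm Omega delta u <= C * (L2_norm Omega f + V_norm Omega delta g)).
Proof.
have mO := open_measurable_rV hopen; have mC := measurable_collar hdelta hopen.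
have [S [N [mS S0 SN SS]]] := ball_kernel_walk hd hbounded hdelta.
have M0 : 0 < (2 * delta) ^+ d by rewrite exprn_gt0// mulr_gt0.
have m0 : 0 < (delta / (2 * d%:R + 1)) ^+ d.
  by rewrite exprn_gt0// divr_gt0// addr_gt0// mulr_gt0// ltr0n.
have OC x : collar Omega delta x -> ~ Omega x by case.
have mk := measurable_ball_kernel (d := d) hdelta.
have k0 := @ball_kernel_ge0 R d delta; have k1 := @ball_kernel_le1 R d delta.
have kC := @ball_kernelC R d delta.
have kM := ball_kernel_row_le (d := d) hdelta.
have kE := @ball_kernel_support R d Omega delta.
split=> [f g hf hg|].
  split.
    exact: (weak_solution_exists mO mk k0 kC M0 kM mS m0 S0 SN SS k1 mC OC kE hf hg).
  move=> u w.
  exact: (weak_solution_unique mO mk k0 kC M0 kM mS m0 S0 SN SS k1 mC OC kE hf hg).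
have [C C0 HC] := weak_solution_bound mO mk k0 kC M0 kM mS m0 S0 SN SS mC OC kE.
exists (Num.sqrt C); first by rewrite sqrtr_gt0.
(* Take square roots in the bound on squares, using sqrt (F + G) <= sqrt F + sqrt G. *)
move=> f g u hf hg hu; have := HC f g u hf hg hu.
rewrite -[iterated_seminorm2 _ _ _ _ u]/(V_sqseminorm Omega delta u).
rewrite -[iterated_seminorm2 _ _ _ _ g]/(V_sqseminorm Omega delta g).
rewrite /V_norm /L2_norm -!/(L2_sqnorm _ _).
have L0 h : (0 <= L2_sqnorm Omega h)%E.
  by apply: integral_ge0 => x _; rewrite lee_fin sqr_ge0.
have V0 h : (0 <= V_sqseminorm Omega delta h)%E.
  apply: integral_ge0 => x _; apply: integral_ge0 => y _.
  by rewrite lee_fin mulr_ge0 ?sqr_ge0 ?(k0 (x, y)).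
have [[_ [_ u2] us] _ _] := hu; have [_ [_ g2] gs] := hg; have [_ f2] := hf.
set U := (_ + V_sqseminorm Omega delta u)%E; set G := (_ + V_sqseminorm Omega delta g)%E.
have Ufin : U \is a fin_num.
  by rewrite ge0_fin_numE; [exact: lte_add_pinfty|exact: adde_ge0].
have Gfin : G \is a fin_num.
  by rewrite ge0_fin_numE; [exact: lte_add_pinfty|exact: adde_ge0].
have Ffin : L2_sqnorm Omega f \is a fin_num by rewrite ge0_fin_numE.
have F0 := fine_ge0 (L0 f); have G0 : 0 <= fine G.
  by apply: fine_ge0; exact: adde_ge0.
rewrite -(fineK Ufin) -(fineK Gfin) -(fineK Ffin) -EFinD -EFinM lee_fin /= => UFG.
apply: le_trans (ler_wsqrtr UFG) _.
rewrite sqrtrM; last exact: ltW.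
rewrite ler_wpM2l ?sqrtr_ge0//.
rewrite -(ler_sqr (x := Num.sqrt _)) ?nnegrE ?addr_ge0 ?sqrtr_ge0//.
rewrite sqrrD !sqr_sqrtr ?addr_ge0// lerD2r lerDl mulrn_wge0//.
Qed.
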